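(* Let $G$ be a second countable compact Hausdorff topological group with normalized Haar measure, and let $\widehat{G}=\{[\pi_n]: n\in\Lambda\cup\{0\}\}$, with $\pi_0$ the trivial representation. Let $f\in L^2(G,\mathbb{C})$ satisfy $\|f\|_{L^2(G,\mathbb{C})}\leq 1$ and $0\leq\widehat{f}(\pi_0)<1$. Let $\{R_n\}_{n\in\Lambda}$ be a sequence of matrices with $R_n\in\mathcal{M}_{d_{\pi_n}}(\mathbb{C})$. For each $n\in\Lambda$, let $\|\cdot\|_{\pi_n}$ be any unitarily invariant norm on $\mathcal{M}_{d_{\pi_n}}(\mathbb{C})$, let $\phi_n$ be any symmetric gauge function on $\mathbb{C}^{d_{\pi_n}^2}$, and let $M_{\chi_n}$ be a generalized matrix function on $\mathcal{M}_{d_{\pi_n}}(\mathbb{C})$, where $\chi_n$ is a character of degree $1$ on a subgroup $H_n$ of the symmetric group $S_{d_{\pi_n}}$. Then, for every interpretation of the products $\boldsymbol{\cdot}$ (see context) and for all $x\in G$: (i) If $(1+\widehat{f}(\pi_0))\left(1+\sum_{n\in\Lambda}d_{\pi_n}\|R_n\|_{\pi_n}^2\right)\leq 2$, then $$\widehat{f}(\pi_0)+\sum_{n\in\Lambda}d_{\pi_n}\left\|\widehat{f}(\pi_n)\boldsymbol{\cdot}\pi_n(x)\boldsymbol{\cdot}R_n\right\|_{\pi_n}\leq 1.$$ (ii) If $(1+\widehat{f}(\pi_0))\left(1+\sum_{n\in\Lambda}d_{\pi_n}^5\phi_n^2(R_n)\right)\leq 2$, then $$\widehat{f}(\pi_0)+\sum_{n\in\Lambda}d_{\pi_n}\phi_n\left(\widehat{f}(\pi_n)\boldsymbol{\cdot}\pi_n(x)\boldsymbol{\cdot}R_n\right)\leq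 1.$$ (iii) If $(1+\widehat{f}(\pi_0))\left(1+\sum_{n\in\Lambda}d_{\pi_n}\dfrac{\|R_n\|_{\pi_n}^2}{\|E_{11}^{(n)}\|_{\pi_n}^2}\right)\leq 2$, then $$\widehat{f}(\pi_0)+\sum_{n\in\Lambda}d_{\pi_n}\left|M_{\chi_n}\left(\widehat{f}(\pi_n)\boldsymbol{\cdot}\pi_n(x)\boldsymbol{\cdot}R_n\right)\right|^{\frac{1}{d_{\pi_n}}}\leq 1.$$ Moreover, if instead $\widehat{f}(\pi_0)=1$ (with $f\in L^2(G,\mathbb{C})$ and $\|f\|_{L^2(G,\mathbb{C})}\leq 1$ as before), then equality holds in each of the three displayed conclusions of (i), (ii) and (iii) for any sequence $\{R_n\}_{n\in\Lambda}$ with $R_n\in\mathcal{M}_{d_{\pi_n}}(\mathbb{C})$, i.e. the $R_n$ need not satisfy any of the conditions on $\{R_n\}$ in (i), (ii), (iii).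
   Context: **Group and representations.** $G$ is a second countable, compact, Hausdorff topological group, not necessarily abelian, with bi-invariant Haar measure $m$ normalized by $m(G)=1$; $dx$ denotes integration with respect to $m$. $\widehat{G}$ is the set of unitary equivalence classes of irreducible unitary (strongly continuous) representations of $G$. It is countable and written $\widehat{G}=\{[\pi_n]:n\in\Lambda\cup\{0\}\}$ (distinct indices for distinct classes), where $\Lambda$ is either $\mathbb{N}=\{1,2,\dots\}$ or a finite set $\{1,\dots,n_0\}$, $\pi_n$ is a chosen representative of its class acting on the Hilbert space $\mathcal{H}_{\pi_n}$, and $d_{\pi_n}=\dim\mathcal{H}_{\pi_n}<\infty$. $\pi_0$ is the trivial representation $\pi_0(x)=1$ on $\mathbb{C}$. Fixing an orthonormal basis $\{e_j\}$ of $\mathcal{H}_{\pi_n}$, $\pi_n(x)$ is identified with the unitary matrix with entries $\pi_n(x)_{ij}=\langle\pi_n(x)e_j,e_i\rangle$. **Fourier transform.** For $f\in L^1(G,\mathbb{C})$ (in particular for $f\in L^2(G,\mathbb{C})$), $\widehat{f}(\pi_n)=\int_G f(x)\pi_n(x)^*\,dx$, regarded as the matrix with entries $\widehat{f}(\pi_n)_{ij}=\int_G f(x)\overline{\pi_n(x)_{ji}}\,dx$. In particular $\widehat{f}(\pi_0)=\int_G f\,dx$. Also $\|f\|_{L^2(G,\mathbb{C})}=\left(\int_G|f(x)|^2dx\right)^{1/2}$. **Matrices.** $\mathcal{M}_d(\mathbb{C})$ is the space of $d\times d$ complex matrices. $E_{11}^{(n)}\in\mathcal{M}_{d_{\pi_n}}(\mathbb{C})$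 has $(1,1)$ entry $1$ and all other entries $0$. $A\circ B$ is the Hadamard (entrywise) product. The symbol $A\boldsymbol{\cdot}B$ denotes either the usual product $AB$ or the Hadamard product $A\circ B$, and $A\boldsymbol{\cdot}B\boldsymbol{\cdot}C$ may be any one of the six matrices $A\circ B\circ C$, $ABC$, $A\circ(BC)$, $A(B\circ C)$, $(A\circ B)C$, $(AB)\circ C$; the results hold for each of these choices. **Norms and functions on matrices.** A norm $\|\cdot\|$ on $\mathcal{M}_d(\mathbb{C})$ is unitarily invariant if $\|UAV\|=\|A\|$ for all unitary $U,V$ and all $A$. A symmetric gauge function on $\mathbb{C}^N$ is a norm $\phi:\mathbb{C}^N\to[0,\infty)$ with $\phi(x_1,\dots,x_N)=\phi(|x_1|,\dots,|x_N|)$ and invariant under permutations of coordinates; for $A\in\mathcal{M}_d(\mathbb{C})$ and $\phi$ on $\mathbb{C}^{d^2}$, $\phi(A)$ is $\phi$ applied to the $d^2$ entries of $A$ listed in any order, and $\phi^2(A)=(\phi(A))^2$. For a subgroup $H\leq S_d$ and a character $\chi$ of degree $1$ on $H$ (a nontrivial, i.e. not identically zero, multiplicative homomorphism of $H$ into the complex numbers), the generalized matrix function is $M_\chi(A)=\sum_{\sigma\in H}\chi(\sigma)\prod_{i=1}^d A_{i\sigma(i)}$, $A\in\mathcal{M}_d(\mathbb{C})$. *)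

(* Defs.v *)
From HB Require Import structures.
From mathcomp Require Import all_boot all_order all_algebra all_fingroup.
From mathcomp Require Import sesquilinear spectral.
From mathcomp Require Import all_classical all_reals all_analysis.
From mathcomp Require Import complex.

Set Implicit Arguments.
Unset Strict Implicit.
Unset Printing Implicit Defensive.

Import Order.TTheory GRing.Theory Num.Theory numFieldNormedType.Exports.

Local Open Scope classical_set_scope.
Local Open Scope ring_scope.
Local Open Scope sesquilinear_scope.

(* MathComp over a realType R, the complex numbers being R[i].
   The pointed structure is only there because a measurableType is pointed;
   [point] need not be the identity of G. *)
HB.mixin Record isTopologicalGroup G of PointedTopological G & monoid.Group G := {
  mulg_continuous : continuous (fun xy : G * G => (xy.1 * xy.2)%g) ;
  invg_continuous : continuous (fun x : G => (x^-1)%g)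
}.

#[short(type="topGroupType")]
HB.structure Definition TopGroup :=
  {G of isTopologicalGroup G & PointedTopological G & monoid.Group G}.

Notation borel G := (g_sigma_algebraType (@open G)).

Definition bi_invariant (R : realType) (G : topGroupType)
    (m : probability (borel G) R) : Prop :=
  forall (x : G) (A : set (borel G)), measurable A ->
    m [set (x * y)%g | y in A] = m A /\ m [set (y * x)%g | y in A] = m A.

(* The norm of R[i] takes its values in R[i]; [cmod] is the same number in R. *)
Definition cmod (R : realType) (z : R[i]) : R := complex.Re `|z|.

Definition complex_measurable_fun d (T : measurableType d) (R : realType)
    (f : T -> R[i]) : Prop :=
  measurable_fun [set: T] (fun x => complex.Re (f x)) /\
  measurable_fun [set: T] (fun x => complex.Im (f x)).

Definition complex_integral d (T : measurableType d) (R : realType)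
    (m : {measure set T -> \bar R}) (f : T -> R[i]) : R[i] :=
  Complex (Rintegral m [set: T] (fun x => complex.Re (f x)))
          (Rintegral m [set: T] (fun x => complex.Im (f x))).

Definition L2norm d (T : measurableType d) (R : realType)
    (m : {measure set T -> \bar R}) (f : T -> R[i]) : \bar R :=
  Lnorm m 2%:E (fun x => (cmod (f x))%:E).

Definition in_L2 d (T : measurableType d) (R : realType)
    (m : {measure set T -> \bar R}) (f : T -> R[i]) : Prop :=
  complex_measurable_fun f /\ (L2norm m f < +oo)%E.

(* A finite-dimensional representation, written in an orthonormal basis of its
   space; a matrix acts on column vectors. *)
Record mxrep (R : realType) (G : topGroupType) := MxRep {
  deg : nat ;
  mxrep_fun :> G -> 'M[R[i]]_deg
}.

Definition trivial_rep (R : realType) (G : topGroupType) : mxrep R G :=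
  @MxRep R G 1 (fun=> 1%:M).

(* R[i] carries its topology only under the alias R[i]^o. *)
Definition unitary_rep (R : realType) (G : topGroupType) (p : mxrep R G) :
    Prop :=
  [/\ p 1%g = 1%:M,
      forall x y : G, p (x * y)%g = p x *m p y,
      forall x : G, p x \is unitarymx &
      forall v : 'cV[R[i]]_(deg p),
        continuous (fun x : G => p x *m v : 'cV[R[i]^o]_(deg p))].

Definition irreducible_rep (R : realType) (G : topGroupType) (p : mxrep R G) :
    Prop :=
  (0 < deg p)%N /\
  forall U : {vspace 'cV[R[i]]_(deg p)},
    (forall (x : G) (v : 'cV[R[i]]_(deg p)), v \in U -> p x *m v \in U) ->
    U = 0%VS \/ U = fullv.

(* For a rectangular W, [W \is unitarymx] only says W *m W^t* = 1; the two
   conditions together make W a unitary map, and force equal degrees. *)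
Definition unitarily_equivalent (R : realType) (G : topGroupType)
    (p q : mxrep R G) : Prop :=
  exists W : 'M[R[i]]_(deg q, deg p),
    [/\ W \is unitarymx, W^t* \is unitarymx &
        forall x : G, W *m p x = q x *m W].

(* [pi_] lists the unitary dual of a compact group, without repetition, over
   the indices 0 |` L; its values at other indices are irrelevant. Irreducible
   unitary representations of a compact group are finite-dimensional, so
   exhaustiveness among matrix representations is exhaustiveness. The case
   n0 = 0 (L empty) is that of the trivial group. *)
Definition enumerates_dual (R : realType) (G : topGroupType)
    (L : set nat) (pi_ : nat -> mxrep R G) : Prop :=
  [/\ L = [set n | (0 < n)%N] \/ exists n0, L = [set n | (0 < n <= n0)%N],
      pi_ 0%N = trivial_rep R G,
      forall n, (0%N |` L) n -> unitary_rep (pi_ n) /\ irreducible_rep (pi_ n),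
      forall n k, (0%N |` L) n -> (0%N |` L) k ->
        unitarily_equivalent (pi_ n) (pi_ k) -> n = k &
      forall p : mxrep R G, unitary_rep p -> irreducible_rep p ->
        exists2 n, (0%N |` L) n & unitarily_equivalent p (pi_ n)].

Definition fourier (R : realType) (G : topGroupType)
    (m : probability (borel G) R) (f : G -> R[i]) (p : mxrep R G) :
    'M[R[i]]_(deg p) :=
  \matrix_(i, j) complex_integral m (fun x : borel G => f x * (p x j i)^*).

Definition is_norm (R : realType) (V : lmodType R[i]) (N : V -> R) : Prop :=
  [/\ forall v, 0 <= N v,
      forall v, N v = 0 -> v = 0,
      forall (a : R[i]) v, N (a *: v) = cmod a * N v &
      forall u v, N (u + v) <= N u + N v].

Definition unitarily_invariant_norm (R : realType) d (N : 'M[R[i]]_d -> R) :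
    Prop :=
  is_norm N /\
  forall U V A : 'M[R[i]]_d, U \is unitarymx -> V \is unitarymx ->
    N (U *m A *m V) = N A.

(* For A : 'M_d and phi on 'rV_(d * d), phi(A) is [phi (mxvec A)]. *)
Definition symmetric_gauge (R : realType) n (phi : 'rV[R[i]]_n -> R) : Prop :=
  [/\ is_norm phi,
      forall v, phi v = phi (map_mx (fun z : R[i] => `|z|) v) &
      forall (s : 'S_n) v, phi (col_perm s v) = phi v].

Definition degree1_character (R : realType) d (H : {group 'S_d})
    (chi : 'S_d -> R[i]) : Prop :=
  (exists2 s, s \in H & chi s != 0) /\
  {in H &, forall s t, chi (s * t)%g = chi s * chi t}.

Definition gen_matrix_fun (R : realType) d (H : {group 'S_d})
    (chi : 'S_d -> R[i]) (A : 'M[R[i]]_d) : R[i] :=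
  \sum_(s in H) chi s * \prod_(i < d) A i (s i).

(* Since d > 0 wherever it is used, its only nonzero entry is at (0, 0). *)
Definition E11 (R : realType) d : 'M[R[i]]_d :=
  \matrix_(i, j) ((val i == 0%N) && (val j == 0%N))%:R.

Definition hadamard (R : realType) d (A B : 'M[R[i]]_d) : 'M[R[i]]_d :=
  \matrix_(i, j) (A i j * B i j).

(* The readings of A . B . C; H stands for the Hadamard product, M for the
   usual one, and in the mixed cases the parenthesized product comes first. *)
Inductive triple_product := HH | MM | H_M | M_H | HM_ | MH_.

Definition triple_mul (R : realType) d (t : triple_product)
    (A B C : 'M[R[i]]_d) : 'M[R[i]]_d :=
  match t with
  | HH  => hadamard (hadamard A B) C
  | MM  => A *m B *m C
  | H_M => hadamard A (B *m C)
  | M_H => A *m hadamard B C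
  | HM_ => hadamard A B *m C
  | MH_ => hadamard (A *m B) C
  end.

(* Main.v *)
Require Import Defs.
From mathcomp Require Import all_boot all_order all_algebra all_fingroup.
From mathcomp Require Import sesquilinear spectral.
From mathcomp Require Import all_classical all_reals all_analysis.
From mathcomp Require Import complex measurable_realfun.
From mathcomp Require Import ring lra.
Import Order.TTheory GRing.Theory Num.Theory numFieldNormedType.Exports.
Local Open Scope classical_set_scope.
Local Open Scope ring_scope.
Local Open Scope sesquilinear_scope.

Set Implicit Arguments.
Unset Strict Implicit.
Unset Printing Implicit Defensive.

(** Write [a] for the mean of [f], [d n] for the degree of [pi_ n] and [h n] for
    the Hilbert-Schmidt norm of the n-th Fourier coefficient of [f].

    Of harmonic analysis only Bessel's inequality
    [a ^+ 2 + \sum_n d n * h n ^+ 2 <= 1] is used ([fourier_bessel]). It comes from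
    the Schur orthogonality relations of the matrix coefficients, and these from
    Schur's lemma and the invariance of Haar measure.

    Suppose that the n-th term of a sum to be bounded is at most
    [d n * h n * nu n]. The weighted arithmetic-geometric inequality
    [2 * h * nu <= h ^+ 2 / (1 + a) + (1 + a) * nu ^+ 2] and Bessel's inequality
    bound twice the sum by
    [(1 - a) + (1 + a) * \sum_n d n * nu n ^+ 2], and the condition on the matrices
    [Rs n] is what makes this at most [2 * (1 - a)] ([esum_le_amgm]). When [a] is 1,
    Bessel's inequality forces every [h n] with n in [L] to vanish, and with it
    every term.

    So all that remains is to bound a function of a triple product of [A] (the
    Fourier coefficient), a unitary [B] and [C] by [hs A] times a constant that
    depends on [C]: [N C] for a unitarily invariant norm, [d * phi C] for a gauge,
    [N C / N E11] for the d-th root of a generalized matrix function. The last of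
    these is dominated by the Hilbert-Schmidt norm of the product
    ([cmod_gen_matrix_fun_root]), so in each case one bounds a norm [Q]. By
    [norm_triple_mul] it is enough to show [Q (X *m C) <= hs X * kappa] for all [X],
    which is [uinorm_mul], [mxgauge_mul] and [hs_mul_uinorm] in the three cases.

    The idea behind [norm_triple_mul] is that a Hadamard product is a mean of usual
    products: for independent uniform signs [s], [A *m hadamard B C] is the mean of
    [(A *m diag (B s)) *m C *m diag s]. A norm that ignores the signs on the right
    is then at most [kappa] times the mean of [hs (A *m diag (B s))], whose second
    moment is [hs A ^+ 2] when the rows of [B] have length 1. This avoids the
    theory of majorization of singular values. *)

(** * The modulus of a complex number as a real number *)

Section Modulus.
Variable R : realType.
Implicit Types z w : R[i].

Lemma cmodE z : `|z| = (cmod z)%:C%C.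
Proof. by rewrite /cmod normc_def. Qed.

Lemma cmod_ge0 z : 0 <= cmod z.
Proof. by rewrite /cmod normc_def /= sqrtr_ge0. Qed.

Lemma cmodK z : (cmod z ^+ 2)%:C%C = z * z^*.
Proof. by rewrite -normCK cmodE rmorphXn. Qed.

Lemma cmod_sqr z : cmod z ^+ 2 = complex.Re z ^+ 2 + complex.Im z ^+ 2.
Proof. by rewrite /cmod normc_def /= sqr_sqrtr// addr_ge0// sqr_ge0. Qed.

Lemma cmodM z w : cmod (z * w) = cmod z * cmod w.
Proof. by apply: complexI; rewrite rmorphM /= -!cmodE normrM. Qed.

Lemma cmodD z w : cmod (z + w) <= cmod z + cmod w.
Proof. by rewrite -lecR rmorphD /= -!cmodE ler_normD. Qed.

Lemma cmod0 : cmod (0 : R[i]) = 0.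
Proof. by apply: complexI; rewrite -cmodE normr0. Qed.

Lemma cmod1 : cmod (1 : R[i]) = 1.
Proof. by apply: complexI; rewrite -cmodE normr1. Qed.

Lemma cmod_eq0 z : (cmod z == 0) = (z == 0).
Proof. by rewrite -(normr_eq0 z) cmodE -(inj_eq (@complexI R)). Qed.

Lemma cmodC z : cmod z^* = cmod z.
Proof. by apply: complexI; rewrite -!cmodE norm_conjC. Qed.

Lemma cmodR (r : R) : cmod r%:C%C = `|r|.
Proof. by rewrite /cmod normc_def /= expr0n /= addr0 sqrtr_sqr. Qed.

Lemma cmodV z : cmod z^-1 = (cmod z)^-1.
Proof. by apply: complexI; rewrite fmorphV /= -!cmodE normfV. Qed.

Lemma cmodX z n : cmod (z ^+ n) = cmod z ^+ n.
Proof. by apply: complexI; rewrite rmorphXn /= -!cmodE normrX. Qed.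

Lemma cmod_sum (I : Type) (r : seq I) (P : pred I) (F : I -> R[i]) :
  cmod (\sum_(i <- r | P i) F i) <= \sum_(i <- r | P i) cmod (F i).
Proof.
rewrite -lecR rmorph_sum /= -cmodE; apply: le_trans (ler_norm_sum _ _ _) _.
by apply: ler_sum => i _; rewrite cmodE.
Qed.

Lemma cmod_prod (I : Type) (r : seq I) (P : pred I) (F : I -> R[i]) :
  cmod (\prod_(i <- r | P i) F i) = \prod_(i <- r | P i) cmod (F i).
Proof. by elim/big_rec2: _ => [|i x y _ <-]; rewrite ?cmod1 ?cmodM. Qed.

Lemma cmod_sign (b : bool) : cmod ((-1) ^+ b : R[i]) = 1.
Proof. by apply: complexI; rewrite -cmodE normr_sign. Qed.

Lemma conjC_realR (r : R) : (r%:C%C)^* = r%:C%C :> R[i].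
Proof. by apply/eqP; rewrite eq_complex /= oppr0 !eqxx. Qed.

Lemma ler_sqr_le (x y : R) : 0 <= y -> x ^+ 2 <= y ^+ 2 -> x <= y.
Proof.
move=> y0 xy; have [x0|/ltW x0] := leP 0 x; last exact: le_trans x0 y0.
by rewrite -(@ler_pXn2r _ 2) // nnegrE.
Qed.

Lemma ReD z w : complex.Re (z + w) = complex.Re z + complex.Re w.
Proof. by case: z w => a b [c d]. Qed.

Lemma ImD z w : complex.Im (z + w) = complex.Im z + complex.Im w.
Proof. by case: z w => a b [c d]. Qed.

Lemma ReM z w :
  complex.Re (z * w) = complex.Re z * complex.Re w - complex.Im z * complex.Im w.
Proof. by case: z w => a b [c d]. Qed.

Lemma ImM z w :
  complex.Im (z * w) = complex.Re z * complex.Im w + complex.Im z * complex.Re w.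
Proof. by case: z w => a b [c d]. Qed.

Lemma ReC z : complex.Re z^* = complex.Re z.
Proof. by case: z. Qed.

Lemma ImC z : complex.Im z^* = - complex.Im z.
Proof. by case: z. Qed.

Lemma norm_Re_le z : `|complex.Re z| <= cmod z.
Proof.
apply: ler_sqr_le (cmod_ge0 _) _.
by rewrite cmod_sqr real_normK ?num_real// lerDl sqr_ge0.
Qed.

Lemma norm_Im_le z : `|complex.Im z| <= cmod z.
Proof.
apply: ler_sqr_le (cmod_ge0 _) _.
by rewrite cmod_sqr real_normK ?num_real// lerDr sqr_ge0.
Qed.

Lemma ReB z w : complex.Re (z - w) = complex.Re z - complex.Re w.
Proof. by case: z w => a b [c d]. Qed.

Lemma ImB z w : complex.Im (z - w) = complex.Im z - complex.Im w.
Proof. by case: z w => a b [c d]. Qed.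

(** Lagrange's identity: the defect is half the sum of the squares
    [(a i * b j - a j * b i) ^+ 2]. *)
Lemma cauchy_schwarz_sum (I : finType) (a b : I -> R) :
  (\sum_i a i * b i) ^+ 2 <= (\sum_i a i ^+ 2) * (\sum_i b i ^+ 2).
Proof.
rewrite -subr_ge0.
have -> : (\sum_i a i ^+ 2) * (\sum_i b i ^+ 2) - (\sum_i a i * b i) ^+ 2 =
    2^-1 * \sum_i \sum_j (a i * b j - a j * b i) ^+ 2.
  apply: (@mulfI _ 2); first by rewrite pnatr_eq0.
  rewrite mulrA divff ?pnatr_eq0// mul1r.
  have -> : \sum_i \sum_j (a i * b j - a j * b i) ^+ 2 =
      \sum_i \sum_j (a i ^+ 2 * b j ^+ 2) + \sum_i \sum_j (a j ^+ 2 * b i ^+ 2)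
      - 2 * \sum_i \sum_j ((a i * b i) * (a j * b j)).
    rewrite mulr_sumr -big_split -sumrB; apply: eq_bigr => i _.
    rewrite mulr_sumr -big_split -sumrB; apply: eq_bigr => j _ /=.
    by ring.
  rewrite [X in _ + X - _]exchange_big /= mulrBr; congr (_ - _ * _).
    rewrite -[RHS]mulr2n -[RHS]mulr_natl; congr (_ * _).
    by rewrite mulr_suml; apply: eq_bigr => i _; rewrite mulr_sumr.
  by rewrite expr2 mulr_suml; apply: eq_bigr => i _; rewrite mulr_sumr.
rewrite mulr_ge0 ?invr_ge0 ?ler0n//.
by apply: sumr_ge0 => i _; apply: sumr_ge0 => j _; exact: sqr_ge0.
Qed.

End Modulus.

(** * The Hilbert-Schmidt norm *)

Section HilbertSchmidt.
Variable R : realType.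

Definition hs m n (A : 'M[R[i]]_(m, n)) : R :=
  Num.sqrt (\sum_i \sum_j cmod (A i j) ^+ 2).

Lemma hs_ge0 m n (A : 'M[R[i]]_(m, n)) : 0 <= hs A.
Proof. exact: sqrtr_ge0. Qed.

Lemma hs_sqr m n (A : 'M[R[i]]_(m, n)) :
  hs A ^+ 2 = \sum_i \sum_j cmod (A i j) ^+ 2.
Proof.
rewrite sqr_sqrtr//.
by apply: sumr_ge0 => i _; apply: sumr_ge0 => j _; exact: sqr_ge0.
Qed.

(** The trace form makes unitary invariance a computation in the ring of
    matrices. *)
Lemma hs_trace m n (A : 'M[R[i]]_(m, n)) : (hs A ^+ 2)%:C%C = \tr (A *m A^t*).
Proof.
rewrite hs_sqr rmorph_sum; apply: eq_bigr => i _ /=.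
rewrite rmorph_sum mxE; apply: eq_bigr => j _ /=.
by rewrite cmodK !mxE.
Qed.

Lemma hs_tr m n (A : 'M[R[i]]_(m, n)) : hs A^T = hs A.
Proof.
congr Num.sqrt; rewrite exchange_big; apply: eq_bigr => i _ /=.
by apply: eq_bigr => j _; rewrite mxE.
Qed.

Lemma hs_adj m n (A : 'M[R[i]]_(m, n)) : hs (A^t*) = hs A.
Proof.
rewrite -[RHS]hs_tr; congr Num.sqrt.
by apply: eq_bigr => i _; apply: eq_bigr => j _; rewrite !mxE cmodC.
Qed.

Lemma hs_unitaryr m n (A : 'M[R[i]]_(m, n)) (U : 'M[R[i]]_n) :
  U \is unitarymx -> hs (A *m U) = hs A.
Proof.
move=> /unitarymxP UU; apply/eqP; rewrite -(@eqrXn2 _ 2)// ?hs_ge0//; apply/eqP.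
apply: complexI; rewrite !hs_trace trmx_mul map_mxM /= mulmxA.
by rewrite -(mulmxA A) UU mulmx1.
Qed.

Lemma cmod_le_hs m n (A : 'M[R[i]]_(m, n)) i j : cmod (A i j) <= hs A.
Proof.
apply: ler_sqr_le (hs_ge0 _) _; rewrite hs_sqr (bigD1 i)//= (bigD1 j)//= -addrA.
rewrite lerDl addr_ge0//; first by apply: sumr_ge0 => k _; exact: sqr_ge0.
by apply: sumr_ge0 => k _; apply: sumr_ge0 => l _; exact: sqr_ge0.
Qed.

Lemma hs_le m n (A B : 'M[R[i]]_(m, n)) :
  (forall i j, cmod (A i j) <= cmod (B i j)) -> hs A <= hs B.
Proof.
move=> AB; apply: ler_wsqrtr; apply: ler_sum => i _; apply: ler_sum => j _.
by rewrite ler_pXn2r// ?nnegrE ?cmod_ge0.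
Qed.

Lemma hs_norm m n : is_norm (@hs m n).
Proof.
split.
- exact: hs_ge0.
- move=> A A0; apply/matrixP => i j; apply/eqP.
  by rewrite mxE -cmod_eq0 eq_le cmod_ge0 -A0 cmod_le_hs.
- move=> a A; rewrite -[cmod a]ger0_norm ?cmod_ge0// -sqrtr_sqr -sqrtrM ?sqr_ge0//.
  congr Num.sqrt; rewrite mulr_sumr; apply: eq_bigr => i _.
  by rewrite mulr_sumr; apply: eq_bigr => j _; rewrite mxE cmodM exprMn.
- move=> A B; apply: ler_sqr_le; first by rewrite addr_ge0 ?hs_ge0.
  have -> : (hs A + hs B) ^+ 2 = hs A ^+ 2 + hs B ^+ 2 + 2 * (hs A * hs B) by ring.
  apply: (@le_trans _ _ (hs A ^+ 2 + hs B ^+ 2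
     + 2 * \sum_i \sum_j cmod (A i j) * cmod (B i j))).
    rewrite !hs_sqr mulr_sumr -!big_split; apply: ler_sum => i _ /=.
    rewrite mulr_sumr -!big_split; apply: ler_sum => j _ /=; rewrite mxE.
    apply: (@le_trans _ _ ((cmod (A i j) + cmod (B i j)) ^+ 2)).
      by rewrite ler_pXn2r ?nnegrE ?addr_ge0 ?cmod_ge0 ?cmodD.
    by rewrite le_eqVlt; apply/orP; left; apply/eqP; ring.
  rewrite lerD2l ler_pM2l//; apply: ler_sqr_le; first by rewrite mulr_ge0 ?hs_ge0.
  rewrite exprMn !hs_sqr !pair_bigA /=.
  exact: (cauchy_schwarz_sum (fun p => cmod (A p.1 p.2)) (fun p => cmod (B p.1 p.2))).
Qed.

End HilbertSchmidt.

(** * Unitarily invariant norms *)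

Section Norms.
Variables (R : realType) (V : lmodType R[i]) (Q : V -> R).
Hypothesis Q_norm : is_norm Q.

Lemma norm_ge0 v : 0 <= Q v.
Proof. by case: Q_norm. Qed.

Lemma normZ a v : Q (a *: v) = cmod a * Q v.
Proof. by case: Q_norm. Qed.

Lemma norm0 : Q 0 = 0.
Proof. by rewrite -(scale0r 0) normZ cmod0 mul0r. Qed.

Lemma norm_triangle u v : Q (u + v) <= Q u + Q v.
Proof. by case: Q_norm. Qed.

Lemma norm_sum (I : Type) (r : seq I) (P : pred I) (F : I -> V) :
  Q (\sum_(i <- r | P i) F i) <= \sum_(i <- r | P i) Q (F i).
Proof.
elim/big_rec2: _ => [|i x y _ le_yx]; first by rewrite norm0.
by apply: le_trans (norm_triangle _ _) _; rewrite lerD2l.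
Qed.

Lemma norm_midpoint u v c :
  Q u <= c -> Q v <= c -> Q (2^-1 *: (u + v)) <= c.
Proof.
move=> uc vc; rewrite normZ cmodV.
have -> : cmod 2 = 2 :> R.
  by rewrite -[2]/(2%:R) -(rmorph_nat (real_complex R)) cmodR ger0_norm.
rewrite mulrC ler_pdivrMr//; apply: le_trans (norm_triangle _ _) _.
by rewrite mulr_natr mulr2n lerD.
Qed.

End Norms.

Section Phase.
Variable R : realType.

(** The point of the unit circle above [t]: [t] is the midpoint of it and of
    its conjugate. This writes a diagonal matrix with entries in [0, 1] as the
    midpoint of two diagonal unitary matrices, and a vector dominated by [v] as
    the midpoint of two vectors with the moduli of [v]. *)
Definition phase (t : R) : R[i] := Complex t (Num.sqrt (1 - t ^+ 2)).

Lemma cmod_phase t : 0 <= t <= 1 -> cmod (phase t) = 1.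
Proof.
move=> /andP[t0 t1]; apply/eqP; rewrite -(@eqrXn2 _ 2) ?cmod_ge0// cmod_sqr /=.
rewrite sqr_sqrtr; first by rewrite addrC subrK expr1n.
by rewrite subr_ge0 expr_le1.
Qed.

Lemma phase_midpoint t : 2^-1 * (phase t + (phase t)^*) = t%:C%C.
Proof.
have -> : phase t + (phase t)^* = 2 * t%:C%C.
  by apply/eqP; rewrite eq_complex /=; apply/andP; split; apply/eqP; ring.
by rewrite mulrA mulVf ?mul1r// pnatr_eq0.
Qed.

End Phase.

Section Contraction.
Variables (R : realType) (d : nat) (N : 'M[R[i]]_d -> R).
Hypothesis N_inv : unitarily_invariant_norm N.

Let N_norm : is_norm N. Proof. by case: N_inv. Qed.

Lemma unitarymx1 n : (1%:M : 'M[R[i]]_n) \is unitarymx.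
Proof. by apply/unitarymxP; rewrite trmx1 map_mx1 mulmx1. Qed.

Lemma uinorm_mull U A : U \is unitarymx -> N (U *m A) = N A.
Proof.
move=> uU; case: N_inv => _ /(_ U 1%:M A uU (unitarymx1 _)).
by rewrite mulmx1.
Qed.

Lemma diag_unitarymx n (w : 'rV[R[i]]_n) :
  (forall i, cmod (w 0 i) = 1) -> diag_mx w \is unitarymx.
Proof.
move=> w1; apply/unitarymxP; rewrite tr_diag_mx map_diag_mx mulmx_diag.
apply/matrixP => i j; rewrite !mxE; have [->|//] := eqVneq i j.
by rewrite -cmodK w1 expr1n.
Qed.

(** [diag t] is the midpoint of two unitary matrices. *)
Lemma uinorm_diag1 (t : 'I_d -> R) A : (forall i, 0 <= t i <= 1) ->
  N (diag_mx (\row_i (t i)%:C%C) *m A) <= N A.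
Proof.
move=> t01; pose w := \row_i phase (t i); pose w' := \row_i (phase (t i))^*.
have -> : \row_i (t i)%:C%C = 2^-1 *: (w + w').
  by apply/rowP => i; rewrite !mxE phase_midpoint.
rewrite linearZ /= linearD /= -scalemxAl mulmxDl.
apply: norm_midpoint => //; rewrite uinorm_mull//; apply: diag_unitarymx => i;
  by rewrite mxE ?cmodC cmod_phase.
Qed.

Lemma uinorm_diag (t : 'I_d -> R) (s : R) A : (forall i, 0 <= t i <= s) ->
  N (diag_mx (\row_i (t i)%:C%C) *m A) <= s * N A.
Proof.
move=> ts; have [s0|s0] := leP s 0.
  have -> : diag_mx (\row_i (t i)%:C%C) = 0.
    apply/matrixP => i j; rewrite !mxE; have /andP[t0 tis] := ts i.
    have -> : t i = 0 by apply: le_anti; rewrite t0 (le_trans tis).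
    by rewrite mul0rn.
  rewrite mul0mx norm0//; have [->|i0] := eqVneq s 0; first by rewrite mul0r.
  case: (pickP 'I_d) => [i _|d0].
    have /andP[t0 tis] := ts i.
    have s_ge0 := le_trans t0 tis.
    by move: i0; rewrite eq_le s0 s_ge0.
  have -> : A = 0 by apply/matrixP => i; have := d0 i.
  by rewrite norm0 ?mulr0.
have -> : \row_i (t i)%:C%C = s%:C%C *: \row_i (t i / s)%:C%C.
  by apply/rowP => i; rewrite !mxE -rmorphM mulrC divfK// gt_eqF.
rewrite linearZ /= -scalemxAl normZ// cmodR (ger0_norm (ltW s0)).
rewrite ler_pM2l//; apply: uinorm_diag1 => i.
have /andP[t0 tis] := ts i.
by rewrite divr_ge0 ?(ltW s0)//= ler_pdivrMr// mul1r.
Qed.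

(** For invertible [A] the spectral theorem applied to [A^t* *m A] gives a
    singular value decomposition [A = U *m D *m V]: [V] is the diagonalizing
    matrix, and the columns of [B := A *m V^t*] are orthogonal and nonzero, so
    dividing them by their lengths, the diagonal of [D], makes [U] unitary. Then
    [U] and [V] do not change the norm, and the entries of [D] are at most
    [hs B = hs A]. *)
Lemma uinorm_mul_unit A C : A \in unitmx -> N (A *m C) <= hs A * N C.
Proof.
move=> uA; pose M := A^t* *m A; pose V := spectralmx M.
have MH : M^t* = M by rewrite /M trmx_mul map_mxM /= trmxCK.
have uV : V \is unitarymx := spectral_unitarymx M.
have VtV : V^t* *m V = 1%:M.
  by rewrite -[RHS](mulVmx (unitarymx_unit uV)) invmx_unitary.
have Mnormal : M \is normalmx by apply/normalmxP; rewrite MH.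
have /orthomx_spectralP MD := Mnormal.
set lam := spectral_diag M in MD.
rewrite -/V invmx_unitary// in MD.
pose B := A *m V^t*.
have BB : B^t* *m B = diag_mx lam.
  rewrite /B trmx_mul map_mxM /= trmxCK mulmxA -(mulmxA V) -/M MD !mulmxA.
  by rewrite (unitarymxP uV) mul1mx -mulmxA (unitarymxP uV) mulmx1.
have uB : B \in unitmx.
  by rewrite unitmx_mul uA -invmx_unitary// unitmx_inv unitarymx_unit.
pose l i := \sum_k cmod (B k i) ^+ 2.
have lamE i : lam 0 i = (l i)%:C%C.
  have /matrixP/(_ i i) := BB; rewrite !mxE eqxx mulr1n => <-.
  by rewrite rmorph_sum; apply: eq_bigr => k _ /=; rewrite cmodK !mxE mulrC.
have l_ge0 i : 0 <= l i by apply: sumr_ge0 => k _; exact: sqr_ge0.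
have l_gt0 i : 0 < l i.
  rewrite lt_neqAle l_ge0 andbT; apply/eqP => l0.
  have Bi0 k : B k i = 0.
    move/esym/eqP: l0; rewrite psumr_eq0; last by move=> ? _; exact: sqr_ge0.
    by move=> /allP/(_ k (mem_index_enum _)); rewrite sqrf_eq0 cmod_eq0 => /eqP.
  have /matrixP/(_ i i) := mulVmx uB; rewrite !mxE eqxx big1; last first.
    by move=> k _; rewrite Bi0 mulr0.
  by move/eqP; rewrite eq_sym oner_eq0.
pose t i : R := Num.sqrt (l i).
have t_gt0 i : 0 < t i by rewrite sqrtr_gt0.
have t_le i : 0 <= t i <= hs A.
  rewrite (ltW (t_gt0 i)) /=; apply: ler_sqr_le; first exact: hs_ge0.
  rewrite sqr_sqrtr//.
  have <- : hs B = hs A by apply: hs_unitaryr; rewrite trmxC_unitary.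
  rewrite hs_sqr exchange_big (bigD1 i)//= lerDl.
  by apply: sumr_ge0 => j _; apply: sumr_ge0 => k _; exact: sqr_ge0.
pose D := diag_mx (\row_i (t i)%:C%C); pose D' := diag_mx (\row_i ((t i)^-1)%:C%C).
have D'D : D' *m D = 1%:M.
  rewrite mulmx_diag; apply/matrixP => i j; rewrite !mxE.
  have [->|//] := eqVneq i j.
  by rewrite -rmorphM /= mulVf// lt0r_neq0.
pose U := B *m D'.
have UB : U *m D *m V = A.
  by rewrite /U -(mulmxA B) D'D mulmx1 /B -mulmxA VtV mulmx1.
have uU : U \is unitarymx.
  rewrite -trmxC_unitary; apply/unitarymxP; rewrite trmxCK.
  rewrite /U trmx_mul map_mxM /= mulmxA -(mulmxA (map_mx _ _)) BB.
  rewrite tr_diag_mx map_diag_mx !mulmx_diag; apply/matrixP => i j; rewrite !mxE.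
  rewrite lamE; case: eqP => // _; rewrite !mulr1n -[l i](@sqr_sqrtr _ (l i))// -/(t i).
  transitivity (((t i)^-1)%:C%C * (t i ^+ 2)%:C%C * ((t i)^-1)%:C%C : R[i]).
    by congr (_ * _ * _); exact: conjC_realR.
  by rewrite -!rmorphM /= expr2 mulrA mulVf ?lt0r_neq0// mul1r divff// lt0r_neq0.
have -> : A *m C = U *m (D *m (V *m C)) by rewrite !mulmxA UB.
rewrite (uinorm_mull _ uU); apply: (le_trans (uinorm_diag _ t_le)).
by rewrite uinorm_mull.
Qed.

(** Of the [d.+1] scalars [e / k.+1], at most [d] are opposite to an
    eigenvalue of [A]. *)
Lemma unitmx_shift (A : 'M[R[i]]_d) (e : R) : 0 < e ->
  exists2 r : R, 0 < r <= e & A + (r%:C%C)%:M \in unitmx.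
Proof.
move=> e0; pose rs :=
    [seq - ((e / k.+1%:R)%:C%C) : R[i] | k <- iota 0 d.+1].
have : ~~ all (root (char_poly A)) rs.
  apply/negP => /max_poly_roots; rewrite size_map size_iota size_char_poly ltnn.
  move=> /(_ (monic_neq0 (char_poly_monic A))) H; suff : false by [].
  apply: H; rewrite map_inj_uniq ?iota_uniq// => i j /oppr_inj/complexI.
  move/(mulfI (lt0r_neq0 e0))/invr_inj/eqP.
  by rewrite eqr_nat => /eqP[].
rewrite -has_predC => /hasP[_ /mapP[k _ ->]] /=; rewrite -eigenvalue_root_char => nev.
exists (e / k.+1%:R).
  by rewrite divr_gt0//= ler_pdivrMr// ler_peMr ?ler1n// ltW.
apply: contraR nev; rewrite -row_free_unit -kermx_eq0 => /rowV0Pn[v vA v0].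
apply/eigenvalueP; exists v => //; move/sub_kermxP: vA.
by rewrite mulmxDr mul_mx_scalar => /eqP; rewrite addr_eq0 -scaleNr => /eqP.
Qed.

(** A singular [A] is a limit of the invertible matrices [A + r%:M], and both
    sides depend continuously on [A]. *)
Lemma uinorm_mul A C : N (A *m C) <= hs A * N C.
Proof.
have := @hs_norm R d d => hsn.
apply/ler_addgt0Pr => e e0.
(* [c] times the shift bounds the error of replacing [A] by [A + r%:M]; the
   added 1 keeps it positive. *)
pose c : R := (hs (1%:M : 'M[R[i]]_d) + 1) * N C + 1.
have c0 : 0 < c.
  by rewrite ltr_wpDl// mulr_ge0 ?addr_ge0 ?hs_ge0 ?(norm_ge0 N_norm).
have [r /andP[r0 re] uA] := @unitmx_shift A (e / c) (divr_gt0 e0 c0).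
have -> : A *m C = (A + (r%:C%C)%:M) *m C + (- r%:C%C) *: C.
  by rewrite mulmxDl mul_scalar_mx scaleNr addrK.
apply: le_trans (norm_triangle N_norm _ _) _.
apply: (@le_trans _ _ ((hs A + r * hs (1%:M : 'M[R[i]]_d)) * N C + r * N C)).
  apply: lerD; last by rewrite normZ// -rmorphN cmodR normrN ger0_norm// ltW.
  apply: le_trans (uinorm_mul_unit _ uA) _.
  rewrite ler_wpM2r ?(norm_ge0 N_norm)//.
  apply: le_trans (norm_triangle hsn _ _) _.
  rewrite lerD2l -[(r%:C%C)%:M]scalemx1 (normZ hsn) cmodR.
  by rewrite ger0_norm// ltW.
rewrite mulrDl -addrA lerD2l -mulrA -mulrDr.
apply: (@le_trans _ _ (e / c * c)); last by rewrite divfK// gt_eqF.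
apply: ler_pM => //; first exact: ltW.
  by rewrite addr_ge0 ?mulr_ge0 ?hs_ge0 ?(norm_ge0 N_norm).
by rewrite /c mulrDl mul1r lerDl.
Qed.

End Contraction.

(** * Averaging over random signs *)

Section Rademacher.
Variables (R : realType) (d : nat).

Definition sgn (s : {ffun 'I_d -> bool}) (i : 'I_d) : R[i] := (-1) ^+ s i.

Lemma sum_sgn_orth (i j : 'I_d) :
  \sum_s sgn s i * sgn s j = (2 ^ d)%:R * (i == j)%:R.
Proof.
have [->|ij] := eqVneq i j.
  rewrite mulr1 (eq_bigr (fun=> 1)); last first.
    by move=> s _; rewrite -expr2 sqrr_sign.
  by rewrite sumr_const card_ffun card_bool card_ord.
rewrite mulr0.
(* Flipping the i-th sign changes the sign of every term. *)
pose flip (s : {ffun 'I_d -> bool}) := [ffun k => if k == i then ~~ s k else s k].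
have flipK : involutive flip.
  by move=> s; apply/ffunP => k; rewrite !ffunE; case: eqP => // _; rewrite negbK.
set S := LHS.
have SN : S = - S.
  rewrite {1}/S (reindex_inj (inv_inj flipK)) -sumrN; apply: eq_bigr => s _ /=.
  by rewrite /sgn !ffunE eqxx [j == i]eq_sym (negbTE ij) signrN mulNr.
apply/eqP; have /eqP := SN; rewrite -addr_eq0 -mulr2n -mulr_natr mulf_eq0.
by rewrite pnatr_eq0 orbF.
Qed.

Lemma sum_sgn_parseval (v : 'I_d -> R[i]) :
  \sum_s cmod (\sum_i v i * sgn s i) ^+ 2 = (2 ^ d)%:R * \sum_i cmod (v i) ^+ 2.
Proof.
apply: complexI; rewrite rmorph_sum /= rmorphM /= rmorph_nat.
transitivity (\sum_s \sum_i \sum_j (v i * (v j)^*) * (sgn s i * sgn s j)).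
  apply: eq_bigr => s _ /=; rewrite cmodK mulr_suml; apply: eq_bigr => i _.
  rewrite rmorph_sum mulr_sumr; apply: eq_bigr => j _ /=.
  rewrite rmorphM /= /sgn rmorph_sign; ring.
rewrite exchange_big rmorph_sum mulr_sumr; apply: eq_bigr => i _ /=.
rewrite exchange_big (bigD1 i)//= [X in _ + X]big1 ?addr0; last first.
  move=> j ji; rewrite -mulr_sumr sum_sgn_orth [i == j]eq_sym (negbTE ji).
  by rewrite !mulr0.
by rewrite -mulr_sumr sum_sgn_orth eqxx mulr1 cmodK mulrC.
Qed.

Definition sgnmx s : 'M[R[i]]_d := diag_mx (\row_i sgn s i).

(** The identity that turns a Hadamard product into usual ones: with
    independent uniform signs [s], the matrix [A *m hadamard B C] is the mean of
    [A *m diag (B s) *m C *m diag s], because the mean of [s l * s j] is the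
    Kronecker symbol. *)
Lemma hadamard_mul_rademacher (A B C : 'M[R[i]]_d) :
  (2 ^ d)%:R *: (A *m hadamard B C) =
  \sum_s A *m diag_mx (\row_k (\sum_l B k l * sgn s l)) *m C *m sgnmx s.
Proof.
apply/matrixP => i j; rewrite summxE !mxE mulr_sumr.
transitivity (\sum_s \sum_k A i k * C k j * \sum_l B k l * (sgn s l * sgn s j)).
  rewrite exchange_big; apply: eq_bigr => k _ /=.
  rewrite -mulr_sumr exchange_big (bigD1 j)//= [X in _ + X]big1 ?addr0; last first.
    by move=> l lj; rewrite -mulr_sumr sum_sgn_orth (negbTE lj) !mulr0.
  rewrite -mulr_sumr sum_sgn_orth eqxx mulr1 mxE; ring.
apply: eq_bigr => s _; rewrite !mul_mx_diag !mxE mulr_suml.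
apply: eq_bigr => k _; rewrite !mxE !mulr_sumr !mulr_suml.
apply: eq_bigr => l _; ring.
Qed.

Lemma sum_le_rms (I : finType) (h : I -> R) (v : R) : 0 <= v ->
  \sum_i h i ^+ 2 <= #|I|%:R * v ^+ 2 -> \sum_i h i <= #|I|%:R * v.
Proof.
move=> v0 hv; apply: ler_sqr_le; first by rewrite mulr_ge0.
have := cauchy_schwarz_sum (fun=> 1) h.
rewrite (eq_bigr h); last by move=> i _; rewrite mul1r.
move=> /le_trans; apply.
rewrite (eq_bigr (fun=> 1)); last by move=> i _; rewrite expr1n.
rewrite sumr_const exprMn expr2 -mulrA.
by apply: ler_wpM2l.
Qed.

Variables (Q : 'M[R[i]]_d -> R) (Q_norm : is_norm Q).
Hypothesis Q_sgn : forall A s, Q (A *m sgnmx s) = Q A.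

(** By the identity above [Q (A *m hadamard B C)] is at most [kappa] times the
    mean of [hs (A *m diag (B s))]; this mean is at most the root mean square,
    which the orthogonality of the signs computes. *)
Lemma norm_mul_hadamard (A B C : 'M[R[i]]_d) (kappa v : R) :
  0 <= kappa -> 0 <= v ->
  (forall X, Q (X *m C) <= hs X * kappa) ->
  \sum_i \sum_k cmod (A i k) ^+ 2 * \sum_l cmod (B k l) ^+ 2 <= v ^+ 2 ->
  Q (A *m hadamard B C) <= v * kappa.
Proof.
move=> k0 v0 QC ABv; pose W s := A *m diag_mx (\row_k (\sum_l B k l * sgn s l)).
have n0 : 0 < (2 ^ d)%:R :> R by rewrite ltr0n expn_gt0.
have cardE : #|{ffun 'I_d -> bool}|%:R = (2 ^ d)%:R :> R.
  by rewrite card_ffun card_bool card_ord.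
rewrite -(ler_pM2l n0).
have <- : Q ((2 ^ d)%:R *: (A *m hadamard B C)) = (2 ^ d)%:R * Q (A *m hadamard B C).
  by rewrite (normZ Q_norm) -(rmorph_nat (real_complex R)) cmodR ger0_norm// ltW.
rewrite hadamard_mul_rademacher; apply: le_trans (norm_sum Q_norm _ _ _) _.
apply: (@le_trans _ _ (\sum_s hs (W s) * kappa)).
  by apply: ler_sum => s _; rewrite Q_sgn; exact: QC.
rewrite -mulr_suml mulrA ler_wpM2r// -cardE; apply: sum_le_rms => //.
rewrite cardE; apply: le_trans (ler_wpM2l (ltW n0) ABv).
rewrite le_eqVlt; apply/orP; left; apply/eqP.
rewrite mulr_sumr -[RHS]/(\sum_(i < d) _).
transitivity (\sum_s \sum_i \sum_k cmod (A i k) ^+ 2 *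
    cmod (\sum_l B k l * sgn s l) ^+ 2).
  apply: eq_bigr => s _; rewrite hs_sqr; apply: eq_bigr => i _.
  by apply: eq_bigr => k _; rewrite /W mul_mx_diag !mxE cmodM exprMn.
rewrite exchange_big; apply: eq_bigr => i _ /=.
rewrite exchange_big mulr_sumr; apply: eq_bigr => k _ /=.
by rewrite -mulr_sumr sum_sgn_parseval mulrCA.
Qed.

Lemma norm_hadamard (X C : 'M[R[i]]_d) (kappa : R) : 0 <= kappa ->
  (forall X, Q (X *m C) <= hs X * kappa) -> Q (hadamard X C) <= hs X * kappa.
Proof.
move=> k0 QC; rewrite -[hadamard X C]mul1mx; apply: norm_mul_hadamard => //.
  exact: hs_ge0.
rewrite hs_sqr; apply: ler_sum => i _; rewrite (bigD1 i)//= [X in _ + X]big1 ?addr0.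
  by rewrite mxE eqxx cmod1 expr1n mul1r.
by move=> k ki; rewrite mxE eq_sym (negbTE ki) cmod0 expr0n mul0r.
Qed.

Lemma unitarymx_row (B : 'M[R[i]]_d) k : B \is unitarymx ->
  \sum_l cmod (B k l) ^+ 2 = 1.
Proof.
move=> /unitarymxP/matrixP/(_ k k); rewrite !mxE eqxx => BB.
apply: complexI; rewrite rmorph_sum -[RHS]BB; apply: eq_bigr => l _ /=.
by rewrite cmodK !mxE.
Qed.

Lemma unitarymx_entry_le1 (B : 'M[R[i]]_d) i j : B \is unitarymx ->
  cmod (B i j) <= 1.
Proof.
move=> uB; apply: ler_sqr_le => //.
rewrite expr1n -(unitarymx_row i uB) (bigD1 j)//= lerDl.
by apply: sumr_ge0 => k _; exact: sqr_ge0.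
Qed.

Lemma hs_hadamard_unitary (A B : 'M[R[i]]_d) : B \is unitarymx ->
  hs (hadamard A B) <= hs A.
Proof.
move=> uB; apply: hs_le => i j; rewrite mxE cmodM ler_piMr ?cmod_ge0//.
exact: unitarymx_entry_le1.
Qed.

(** All readings of the triple product at once: a bound of [Q] for the usual
    product with [C] suffices. Both kinds of product by a unitary matrix can be
    absorbed: [hs (A *m B) = hs A] and [hs (hadamard A B) <= hs A]; a Hadamard
    product with [C] is handled by the averaging lemma, where in
    [A *m hadamard B C] the rows of [B] have length 1. *)
Lemma norm_triple_mul (t : triple_product) (A B C : 'M[R[i]]_d) (kappa : R) :
  0 <= kappa -> (forall X, Q (X *m C) <= hs X * kappa) -> B \is unitarymx ->
  Q (triple_mul t A B C) <= hs A * kappa.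
Proof.
move=> k0 QC uB; case: t => /=.
- apply: le_trans (norm_hadamard _ k0 QC) _.
  by rewrite ler_wpM2r// hs_hadamard_unitary.
- by apply: le_trans (QC _) _; rewrite hs_unitaryr.
- apply: norm_hadamard => // X; rewrite mulmxA.
  by apply: le_trans (QC _) _; rewrite hs_unitaryr.
- apply: norm_mul_hadamard => //; first exact: hs_ge0.
  rewrite hs_sqr; apply: ler_sum => i _; apply: ler_sum => k _.
  by rewrite unitarymx_row// mulr1.
- apply: le_trans (QC _) _.
  by rewrite ler_wpM2r// hs_hadamard_unitary.
- by rewrite -(hs_unitaryr A uB); exact: norm_hadamard.
Qed.

End Rademacher.

(** * Symmetric gauge functions *)

Lemma sgnmx_unitary (R : realType) d (s : {ffun 'I_d -> bool}) :
  sgnmx R s \is unitarymx.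
Proof. by apply: diag_unitarymx => i; rewrite mxE cmod_sign. Qed.

Section Gauge.
Variables (R : realType) (n : nat) (phi : 'rV[R[i]]_n -> R).
Hypothesis phi_gauge : symmetric_gauge phi.

Let phi_norm : is_norm phi. Proof. by case: phi_gauge. Qed.

Lemma gauge_abs (u v : 'rV[R[i]]_n) :
  (forall i, cmod (u 0 i) = cmod (v 0 i)) -> phi u = phi v.
Proof.
case: phi_gauge => _ abs _ uv; rewrite abs [RHS]abs; congr phi.
by apply/rowP => i; rewrite !mxE !cmodE uv.
Qed.

(** Up to unimodular factors, which [phi] ignores, [u] is the midpoint of two
    vectors with the moduli of [v]. *)
Lemma gauge_le (u v : 'rV[R[i]]_n) :
  (forall i, cmod (u 0 i) <= cmod (v 0 i)) -> phi u <= phi v.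
Proof.
move=> uv; pose t i := cmod (u 0 i) / cmod (v 0 i).
have t01 i : 0 <= t i <= 1.
  rewrite divr_ge0 ?cmod_ge0//=; have [v0|v0] := eqVneq (cmod (v 0 i)) 0.
    by rewrite /t v0 invr0 mulr0.
  by rewrite ler_pdivrMr ?mul1r// lt_neqAle eq_sym v0 cmod_ge0.
pose w := \row_i (phase (t i) * v 0 i); pose w' := \row_i ((phase (t i))^* * v 0 i).
rewrite (@gauge_abs u (2^-1 *: (w + w'))); last first.
  move=> i; rewrite !mxE -mulrDl mulrA phase_midpoint cmodM cmodR.
  have /andP[t0 _] := t01 i; rewrite ger0_norm// /t.
  have [v0|v0] := eqVneq (cmod (v 0 i)) 0; last by rewrite divfK.
  by rewrite v0 mulr0; apply: le_anti; rewrite -{1}v0 uv cmod_ge0.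
apply: norm_midpoint => //; rewrite le_eqVlt; apply/orP; left; apply/eqP;
  apply: gauge_abs => i; by rewrite mxE cmodM ?cmodC cmod_phase// mul1r.
Qed.

End Gauge.

Section MatrixGauge.
Variables (R : realType) (d : nat) (phi : 'rV[R[i]]_(d * d) -> R).
Hypothesis phi_gauge : symmetric_gauge phi.

Let phi_norm : is_norm phi. Proof. by case: phi_gauge. Qed.

Lemma mxgauge_norm : is_norm (fun A : 'M[R[i]]_d => phi (mxvec A)).
Proof.
split.
- by move=> A; exact: norm_ge0.
- case: phi_norm => _ def _ _ A /def A0; rewrite -[A]mxvecK A0.
  exact: linear0.
- by move=> a A; rewrite linearZ normZ.
- by move=> A B; rewrite linearD norm_triangle.
Qed.

Lemma mxgauge_le (A B : 'M[R[i]]_d) :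
  (forall i j, cmod (A i j) <= cmod (B i j)) -> phi (mxvec A) <= phi (mxvec B).
Proof.
move=> AB; apply: (gauge_le phi_gauge) => k.
by case/mxvec_indexP: k => i j; rewrite !mxvecE.
Qed.

(** A permutation of the rows is a permutation of the [d * d] entries. *)
Lemma mxgauge_row_perm (p : 'S_d) (A : 'M[R[i]]_d) :
  phi (mxvec (row_perm p A)) = phi (mxvec A).
Proof.
(* [f] is the permutation of the entry positions, read off a matrix of
   positions. *)
pose f := mxvec (\matrix_(i < d, j < d) mxvec_index (p i) j) 0.
have fE i j : f (mxvec_index i j) = mxvec_index (p i) j by rewrite /f mxvecE mxE.
have f_inj : injective f.
  move=> k l; case/mxvec_indexP: k => i j; case/mxvec_indexP: l => i' j'.
  by rewrite !fE => /cast_ord_inj/enum_rank_inj[/perm_inj -> ->].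
case: phi_gauge => _ _ /(_ (perm f_inj) (mxvec A)) <-; congr phi.
apply/rowP => k; rewrite mxE permE; case/mxvec_indexP: k => i j.
by rewrite fE !mxvecE mxE.
Qed.

Lemma mxgauge_sgn (A : 'M[R[i]]_d) s : phi (mxvec (A *m sgnmx R s)) = phi (mxvec A).
Proof.
apply: (gauge_abs phi_gauge) => k; case/mxvec_indexP: k => i j.
by rewrite !mxvecE mul_mx_diag !mxE cmodM cmod_sign mulr1.
Qed.

End MatrixGauge.

(** The (i, j) entry of [X *m C] is at most [hs X] times the sum of the moduli
    in column j of [C]. This sum is the (i, j) entry of the sum of the [d]
    matrices obtained from the moduli of [C] by cyclic shifts of the rows, each
    of which has the gauge of [C]. *)
Lemma mxgauge_mul (R : realType) d (phi : 'rV[R[i]]_(d * d) -> R)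
    (X C : 'M[R[i]]_d) : symmetric_gauge phi ->
  phi (mxvec (X *m C)) <= hs X * (d%:R * phi (mxvec C)).
Proof.
(* The cyclic shifts use the additive group on ['I_d.+1]. *)
case: d phi X C => [|d] phi X C phi_gauge.
  have -> : X *m C = 0 by apply/matrixP => -[].
  rewrite linear0 (norm0 (let: And3 h _ _ := phi_gauge in h)).
  by rewrite mul0r mulr0.
have g_norm := mxgauge_norm phi_gauge.
pose M (s : 'I_d.+1) := row_perm (perm (@addIr _ s)) (map_mx (fun z : R[i] => `|z|) C).
have gM s : phi (mxvec (M s)) = phi (mxvec C).
  rewrite mxgauge_row_perm//; apply: (gauge_abs phi_gauge) => k.
  by case/mxvec_indexP: k => i j; rewrite !mxvecE mxE cmodE cmodR ger0_norm ?cmod_ge0.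
apply: (@le_trans _ _ (phi (mxvec ((hs X)%:C%C *: \sum_s M s)))).
  apply: mxgauge_le => // i j; rewrite !mxE cmodM cmodR ger0_norm ?hs_ge0// summxE.
  apply: le_trans (cmod_sum _ _ _) _.
  have -> : \sum_s M s i j = (\sum_k cmod (C k j))%:C%C.
    rewrite [in RHS](reindex_inj (@addrI _ i)) rmorph_sum; apply: eq_bigr => s _ /=.
    by rewrite !mxE permE cmodE.
  rewrite cmodR ger0_norm; last by apply: sumr_ge0 => k _; exact: cmod_ge0.
  rewrite mulr_sumr; apply: ler_sum => k _; rewrite cmodM.
  by rewrite ler_wpM2r ?cmod_ge0// cmod_le_hs.
rewrite (normZ g_norm) cmodR ger0_norm ?hs_ge0// ler_wpM2l ?hs_ge0//.
apply: le_trans (norm_sum g_norm _ _ _) _; rewrite (eq_bigr _ (fun s _ => gM s)).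
by rewrite sumr_const card_ord mulr_natl.
Qed.

(** * Comparison of a unitarily invariant norm with the operator norm *)

Section OperatorBound.
Variables (R : realType) (d : nat) (N : 'M[R[i]]_d -> R).
Hypothesis N_inv : unitarily_invariant_norm N.

Let N_norm : is_norm N. Proof. by case: N_inv. Qed.

Lemma uinorm_mulr A U : U \is unitarymx -> N (A *m U) = N A.
Proof.
move=> uU; case: N_inv => _ /(_ 1%:M U A (unitarymx1 _ _) uU).
by rewrite mul1mx.
Qed.

(** Exchanges left and right multiplication. *)
Lemma uinorm_tr : unitarily_invariant_norm (fun A => N A^T).
Proof.
split; first split.
- by move=> A; exact: norm_ge0.
- case: N_norm => _ def _ _ A /def A0; rewrite -[A]trmxK A0; exact: trmx0.
- by move=> a A; rewrite linearZ normZ.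
- by move=> A B; rewrite linearD norm_triangle.
move=> U V A uU uV; rewrite !trmx_mul mulmxA; case: N_inv => _; apply;
  by rewrite trmx_unitary.
Qed.

Lemma uinorm_mul_right A C : N (C *m A) <= hs A * N C.
Proof.
have := uinorm_mul uinorm_tr A^T C^T.
by rewrite -trmx_mul !trmxK hs_tr.
Qed.

Lemma hs_rank1 m n (u : 'cV[R[i]]_m) (v : 'rV[R[i]]_n) : hs (u *m v) = hs u * hs v.
Proof.
apply/eqP; rewrite -(@eqrXn2 _ 2) ?mulr_ge0 ?hs_ge0// exprMn !hs_sqr; apply/eqP.
rewrite mulr_suml; apply: eq_bigr => i _; rewrite !big_ord1 mulr_sumr.
by apply: eq_bigr => j _; rewrite mxE big_ord1 cmodM exprMn.
Qed.

Lemma hs_delta m n i j : hs (delta_mx i j : 'M[R[i]]_(m, n)) = 1.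
Proof.
apply/eqP; rewrite -(@eqrXn2 _ 2) ?hs_ge0// expr1n hs_sqr (bigD1 i)//= (bigD1 j)//=.
rewrite mxE !eqxx cmod1 expr1n !big1 ?addr0// => [k|k] kn; last first.
  by rewrite mxE eqxx (negbTE kn) cmod0 expr0n.
by rewrite big1// => l _; rewrite mxE (negbTE kn) cmod0 expr0n.
Qed.

Hypothesis d_gt0 : (0 < d)%N.

Let i0 : 'I_d := Ordinal d_gt0.

Lemma E11_delta : E11 R d = delta_mx i0 i0.
Proof. by apply/matrixP => i j; rewrite !mxE -!val_eqE. Qed.

Lemma uinorm_E11_gt0 : 0 < N (E11 R d).
Proof.
rewrite lt_neqAle norm_ge0// andbT eq_sym; apply/eqP => N0.
case: N_norm => _ /(_ _ N0) E0 _ _; have := hs_delta i0 i0.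
rewrite -E11_delta E0 (norm0 (@hs_norm R d d)) => /esym/eqP.
by rewrite oner_eq0.
Qed.

(** With [y = x *m C], sandwich [C] between the matrix whose only nonzero
    row, the first, is [x] and the one whose only nonzero column, the first, is
    [y^t*]: the result is [hs y ^+ 2 *: E11], and
    the two outer factors have Hilbert-Schmidt norms [hs x] and [hs y]. *)
Lemma hs_row_mul_le (x : 'rV[R[i]]_d) C :
  hs (x *m C) * N (E11 R d) <= hs x * N C.
Proof.
pose y := x *m C; rewrite -/y.
have [y0|y0] := eqVneq (hs y) 0.
  by rewrite y0 mul0r mulr_ge0 ?hs_ge0 ?norm_ge0.
have y_gt0 : 0 < hs y by rewrite lt_neqAle eq_sym y0 hs_ge0.
have E : (delta_mx i0 0 *m x) *m (C *m (y^t* *m delta_mx 0 i0)) =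
    (hs y ^+ 2)%:C%C *: E11 R d.
  rewrite mulmxA -(mulmxA _ x C) -/y mulmxA -(mulmxA _ y).
  rewrite [y *m _]mx11_scalar -/(\tr _) -mulmxA mul_scalar_mx -scalemxAr.
  by rewrite mul_delta_mx -E11_delta hs_trace /mxtrace big_ord1.
rewrite -(ler_pM2l y_gt0) mulrA -expr2.
have <- : N ((hs y ^+ 2)%:C%C *: E11 R d) = hs y ^+ 2 * N (E11 R d).
  by rewrite normZ// cmodR ger0_norm ?sqr_ge0.
rewrite -E; apply: le_trans (uinorm_mul N_inv _ _) _.
rewrite hs_rank1 hs_delta mul1r mulrCA ler_wpM2l ?hs_ge0//.
apply: le_trans (uinorm_mul_right _ _) _.
by rewrite hs_rank1 hs_delta mulr1 hs_adj.
Qed.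

(** Row by row: this says that the operator norm of [C] is at most
    [N C / N E11]. *)
Lemma hs_mul_uinorm (X C : 'M[R[i]]_d) :
  hs (X *m C) <= hs X * (N C / N (E11 R d)).
Proof.
have N11 := uinorm_E11_gt0.
rewrite mulrA ler_pdivlMr//.
apply: ler_sqr_le; first by rewrite mulr_ge0 ?hs_ge0 ?norm_ge0.
have hs_rows (Y : 'M[R[i]]_d) : hs Y ^+ 2 = \sum_i hs (row i Y) ^+ 2.
  rewrite hs_sqr; apply: eq_bigr => i _; rewrite hs_sqr big_ord1.
  by apply: eq_bigr => j _; rewrite mxE.
rewrite !exprMn !hs_rows !mulr_suml; apply: ler_sum => i _.
rewrite row_mul -!exprMn ler_pXn2r ?nnegrE ?mulr_ge0 ?hs_ge0 ?norm_ge0//.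
exact: hs_row_mul_le.
Qed.

End OperatorBound.

(** * Generalized matrix functions *)

Section GeneralizedMatrixFunction.
Variables (R : realType) (d : nat) (H : {group 'S_d}) (chi : 'S_d -> R[i]).
Hypothesis chi_char : degree1_character H chi.

(** [s] has finite order, so [chi s] is a root of unity. *)
Lemma cmod_character s : s \in H -> cmod (chi s) = 1.
Proof.
case: chi_char => -[s0 Hs0 chi0] chiM Hs.
have chi1 : chi 1%g = 1.
  apply: (mulfI chi0); rewrite mulr1 -chiM// ?group1//.
  by rewrite mulg1.
have chiX k : chi (s ^+ k)%g = chi s ^+ k.
  elim: k => [|k IHk]; first by rewrite expg0 expr0.
  by rewrite expgS exprS chiM ?groupX// IHk.
have := chiX #[s]%g; rewrite expg_order chi1 => /(congr1 (@cmod R)).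
rewrite cmod1 cmodX => /esym/eqP.
by rewrite pexpr_eq1 ?order_gt0 ?cmod_ge0// => /eqP.
Qed.

(** The sum over [H] is dominated by the expansion of the product of the row
    sums of moduli. By the Cauchy-Schwarz inequality the square of a row sum is
    at most [d] times the square of the length of the row, and the arithmetic
    mean of these [d] bounds is [hs A ^+ 2]. *)
Lemma cmod_gen_matrix_fun (A : 'M[R[i]]_d) : (0 < d)%N ->
  cmod (gen_matrix_fun H chi A) <= hs A ^+ d.
Proof.
move=> d0; apply: (@le_trans _ _ (\prod_i \sum_j cmod (A i j))).
  apply: le_trans (cmod_sum _ _ _) _.
  apply: (@le_trans _ _ (\sum_(s in H) \prod_i cmod (A i (s i)))).
    by apply: ler_sum => s Hs; rewrite cmodM cmod_character// mul1r cmod_prod.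
  rewrite bigA_distr_bigA /=.
  have F0 (g : {ffun 'I_d -> 'I_d}) : 0 <= \prod_i cmod (A i (g i)).
    by apply: prodr_ge0 => i _; exact: cmod_ge0.
  rewrite [X in _ <= X](bigID (fun g : {ffun 'I_d -> 'I_d} => injectiveb g))/=.
  apply: (@le_trans _ _ (\sum_(s : 'S_d) \prod_i cmod (A i (s i)))).
    rewrite [X in _ <= X](bigID (fun s => s \in H)) /= lerDl.
    by apply: sumr_ge0 => s _; apply: prodr_ge0 => i _; exact: cmod_ge0.
  rewrite (reindex (@pval _)) /=; last first.
    pose g0 : 'S_d := 1%g.
    exists (fun f => insubd g0 f) => [s _|f If]; first by rewrite valKd.
    by rewrite [LHS](val_insubd g0) (If : injectiveb f).
  rewrite (eq_bigl predT); last by move=> s; rewrite (valP s).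
  rewrite -[X in X <= _]addr0 lerD//; last exact: sumr_ge0.
  by apply: ler_sum => s _; rewrite le_eqVlt; apply/orP; left; apply/eqP;
     apply: eq_bigr => i _; rewrite pvalE.
apply: ler_sqr_le; first by rewrite exprn_ge0 ?hs_ge0.
rewrite -prodrXl exprAC hs_sqr.
have d0R : 0 < d%:R :> R by rewrite ltr0n.
apply: (@le_trans _ _ (\prod_(i < d) (d%:R * \sum_j cmod (A i j) ^+ 2))).
  apply: ler_prod => i _; rewrite sqr_ge0 /=.
  have := cauchy_schwarz_sum (fun=> 1) (fun j => cmod (A i j)).
  rewrite [X in X ^+ 2 <= _ -> _](eq_bigr (fun j => cmod (A i j))); last first.
    by move=> j _; rewrite mul1r.
  rewrite [X in _ <= X * _ -> _](eq_bigr (fun=> 1)); last by move=> j _; rewrite expr1n.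
  by rewrite sumr_const card_ord.
have [] := @leif_AGM R 'I_d predT (fun i => d%:R * \sum_j cmod (A i j) ^+ 2).
  by move=> i _; rewrite mulr_ge0// sumr_ge0// => j _; exact: sqr_ge0.
move=> le_agm _; apply: le_trans le_agm _.
by rewrite card_ord -mulr_sumr mulrAC divff ?mul1r// lt0r_neq0.
Qed.

Lemma cmod_gen_matrix_fun_root (A : 'M[R[i]]_d) : (0 < d)%N ->
  cmod (gen_matrix_fun H chi A) `^ (d%:R)^-1 <= hs A.
Proof.
move=> d0; have d0R : 0 < d%:R :> R by rewrite ltr0n.
apply: (@le_trans _ _ ((hs A ^+ d) `^ (d%:R)^-1)).
  apply: ge0_ler_powR; rewrite ?nnegrE ?invr_ge0 ?ler0n ?cmod_ge0//.
    by rewrite exprn_ge0 ?hs_ge0.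
  exact: cmod_gen_matrix_fun.
by rewrite -powR_mulrn ?hs_ge0// -powRrM mulfV ?powRr1 ?hs_ge0// lt0r_neq0.
Qed.

End GeneralizedMatrixFunction.

(** * Norms, gauges and matrix functions of a triple product *)

Section TripleBounds.
Variables (R : realType) (d : nat) (t : triple_product).
Variables (A B C : 'M[R[i]]_d).
Hypothesis uB : B \is unitarymx.

Lemma uinorm_triple_mul N : unitarily_invariant_norm N ->
  N (triple_mul t A B C) <= hs A * N C.
Proof.
move=> N_inv; have N_norm : is_norm N by case: N_inv.
apply: norm_triple_mul => //.
- by move=> X s; rewrite uinorm_mulr// sgnmx_unitary.
- exact: norm_ge0.
- by move=> X; exact: uinorm_mul.
Qed.

Lemma gauge_triple_mul phi : symmetric_gauge phi ->
  phi (mxvec (triple_mul t A B C)) <= hs A * (d%:R * phi (mxvec C)).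
Proof.
move=> phi_gauge; have g_norm := mxgauge_norm phi_gauge.
apply: (@norm_triple_mul R d _ g_norm _ t A B C (d%:R * phi (mxvec C))) => //.
- by move=> X s; rewrite mxgauge_sgn.
- by rewrite mulr_ge0// (norm_ge0 g_norm).
- by move=> X; exact: mxgauge_mul.
Qed.

Lemma gen_matrix_fun_triple_mul N (H : {group 'S_d}) chi :
  (0 < d)%N -> unitarily_invariant_norm N -> degree1_character H chi ->
  cmod (gen_matrix_fun H chi (triple_mul t A B C)) `^ (d%:R)^-1
    <= hs A * (N C / N (E11 R d)).
Proof.
move=> d0 N_inv chi_char; have N_norm : is_norm N by case: N_inv.
apply: le_trans (cmod_gen_matrix_fun_root chi_char _ d0) _.
apply: (@norm_triple_mul R d _ (@hs_norm R d d) _ t A B C (N C / N (E11 R d))) => //.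
- by move=> X s; rewrite hs_unitaryr// sgnmx_unitary.
- by rewrite divr_ge0// (norm_ge0 N_norm).
- by move=> X; exact: hs_mul_uinorm.
Qed.

End TripleBounds.

(** * Complex integrals and Bessel's inequality *)

Section ComplexIntegral.
Context d (T : measurableType d) (R : realType).
Variable m : probability T R.
Implicit Types f g : T -> R[i].

Definition cintegrable f : Prop :=
  m.-integrable [set: T] (EFin \o (fun x => complex.Re (f x))) /\
  m.-integrable [set: T] (EFin \o (fun x => complex.Im (f x))).

Lemma complex_measurableM f g : complex_measurable_fun f ->
  complex_measurable_fun g -> complex_measurable_fun (fun x => f x * g x).
Proof.
move=> [mf1 mf2] [mg1 mg2]; split.
  under eq_fun do rewrite ReM.
  by apply: measurable_funB; exact: measurable_funM.
under eq_fun do rewrite ImM.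
by apply: measurable_funD; exact: measurable_funM.
Qed.

Lemma complex_measurableC f : complex_measurable_fun f ->
  complex_measurable_fun (fun x => (f x)^*).
Proof.
move=> [mf1 mf2]; split.
  by under eq_fun do rewrite ReC.
under eq_fun do rewrite ImC.
exact: measurableT_comp.
Qed.

Lemma cintegrable_dominated f (h : T -> R) : complex_measurable_fun f ->
  m.-integrable [set: T] (EFin \o h) -> (forall x, cmod (f x) <= h x) ->
  cintegrable f.
Proof.
move=> [mf1 mf2] ih fh; split.
- apply: le_integrable ih => //; first exact/measurable_EFinP.
  move=> x _; rewrite lee_fin (le_trans (norm_Re_le _))//.
  by rewrite (le_trans (fh x))// ler_norm.
- apply: le_integrable ih => //; first exact/measurable_EFinP.
  move=> x _; rewrite lee_fin (le_trans (norm_Im_le _))//.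
  by rewrite (le_trans (fh x))// ler_norm.
Qed.

Lemma integrable_cst (c : R) : m.-integrable [set: T] (EFin \o (fun=> c)).
Proof. exact: finite_measure_integrable_cst. Qed.

Lemma cintegrable_bounded f M : complex_measurable_fun f ->
  (forall x, cmod (f x) <= M) -> cintegrable f.
Proof. by move=> mf; apply: cintegrable_dominated => //; exact: integrable_cst. Qed.

Lemma cintegrableD f g : cintegrable f -> cintegrable g ->
  cintegrable (fun x => f x + g x).
Proof.
move=> [f1 f2] [g1 g2]; split.
  under eq_fun do rewrite ReD.
  exact: (integrableD measurableT f1 g1).
under eq_fun do rewrite ImD.
exact: (integrableD measurableT f2 g2).
Qed.

Lemma complex_integralD f g : cintegrable f -> cintegrable g ->
  complex_integral m (fun x => f x + g x) =
  complex_integral m f + complex_integral m g.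
Proof.
move=> [f1 f2] [g1 g2]; rewrite /complex_integral.
under eq_Rintegral do rewrite ReD.
rewrite [X in Complex _ X](@eq_Rintegral _ _ _ m setT
  (fun x => complex.Im (f x) + complex.Im (g x))); last first.
  by move=> x _; rewrite ImD.
by rewrite !RintegralD.
Qed.

Lemma cintegrableZ (c : R[i]) f : cintegrable f -> cintegrable (fun x => c * f x).
Proof.
move=> [f1 f2]; split.
  under eq_fun do rewrite ReM.
  have := integrableB measurableT (integrableZl measurableT (complex.Re c) f1)
    (integrableZl measurableT (complex.Im c) f2).
  by apply: eq_integrable.
under eq_fun do rewrite ImM.
have := integrableD measurableT (integrableZl measurableT (complex.Re c) f2)
    (integrableZl measurableT (complex.Im c) f1).
by apply: eq_integrable.
Qed.

Lemma RintegrableZ (c : R) (h : T -> R) : m.-integrable [set: T] (EFin \o h) ->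
  m.-integrable [set: T] (EFin \o (fun x => c * h x)).
Proof.
by move=> ih; have := integrableZl measurableT c ih; apply: eq_integrable.
Qed.

Lemma complex_integralZ (c : R[i]) f : cintegrable f ->
  complex_integral m (fun x => c * f x) = c * complex_integral m f.
Proof.
move=> [f1 f2]; rewrite /complex_integral.
rewrite (@eq_Rintegral _ _ _ m setT (fun x =>
  complex.Re c * complex.Re (f x) - complex.Im c * complex.Im (f x))); last first.
  by move=> x _; rewrite ReM.
rewrite [X in Complex _ X](@eq_Rintegral _ _ _ m setT (fun x =>
  complex.Re c * complex.Im (f x) + complex.Im c * complex.Re (f x))); last first.
  by move=> x _; rewrite ImM.
rewrite RintegralB//; [|exact: RintegrableZ|exact: RintegrableZ].
rewrite RintegralD//; [|exact: RintegrableZ|exact: RintegrableZ].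
rewrite !RintegralZl//.
by apply/eqP; rewrite eq_complex ReM ImM /= !eqxx.
Qed.

Lemma cintegrable0 : cintegrable (fun=> 0).
Proof. by split; exact: integrable_cst. Qed.

Lemma complex_integral_cst c : complex_integral m (fun=> c) = c.
Proof.
rewrite /complex_integral !Rintegral_cst//.
have -> : fine (m [set: T]) = 1 by rewrite [m _]probability_setT.
rewrite !mulr1.
by case: c.
Qed.

Lemma cintegrable_sum (I : Type) (s : seq I) (P : pred I) (F : I -> T -> R[i]) :
  (forall i, P i -> cintegrable (F i)) ->
  cintegrable (fun x => \sum_(i <- s | P i) F i x).
Proof.
move=> iF; elim: s => [|i s IHs].
  by under eq_fun do rewrite big_nil; exact: cintegrable0.
under eq_fun do rewrite big_cons.
by case: (boolP (P i)) => // Pi; apply: cintegrableD => //; exact: iF.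
Qed.

Lemma complex_integral_sum (I : Type) (s : seq I) (P : pred I) (F : I -> T -> R[i]) :
  (forall i, P i -> cintegrable (F i)) ->
  complex_integral m (fun x => \sum_(i <- s | P i) F i x) =
  \sum_(i <- s | P i) complex_integral m (F i).
Proof.
move=> iF; elim: s => [|i s IHs].
  under eq_fun do rewrite big_nil.
  by rewrite big_nil complex_integral_cst.
under eq_fun do rewrite big_cons.
rewrite big_cons; case: (boolP (P i)) => // Pi.
by rewrite complex_integralD ?IHs//; [exact: iF|exact: cintegrable_sum].
Qed.

Lemma cintegrableC f : cintegrable f -> cintegrable (fun x => (f x)^*).
Proof.
move=> [f1 f2]; split.
  by under eq_fun do rewrite ReC.
under eq_fun do rewrite ImC.
by have := integrableN f2; apply: eq_integrable.
Qed.

Lemma complex_integralC f : cintegrable f ->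
  complex_integral m (fun x => (f x)^*) = (complex_integral m f)^*.
Proof.
move=> [f1 f2]; rewrite /complex_integral.
rewrite (@eq_Rintegral _ _ _ m setT (fun x => complex.Re (f x))); last first.
  by move=> x _; rewrite ReC.
rewrite [X in Complex _ X](@eq_Rintegral _ _ _ m setT
  (fun x => (-1) * complex.Im (f x))); last first.
  by move=> x _; rewrite ImC mulN1r.
by rewrite RintegralZl// mulN1r.
Qed.

Lemma complex_integral_cmod_sqr f :
  complex_integral m (fun x => f x * (f x)^*) = (\int[m]_x (cmod (f x) ^+ 2))%:C%C.
Proof.
rewrite /complex_integral.
rewrite (@eq_Rintegral _ _ _ m setT (fun x => cmod (f x) ^+ 2)); last first.
  by move=> x _; rewrite -cmodK.
rewrite [X in Complex _ X](@eq_Rintegral _ _ _ m setT (fun=> 0)); last first.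
  by move=> x _; rewrite -cmodK.
by rewrite Rintegral_cst// mul0r.
Qed.

Lemma complex_measurable_cmod_sqr f : complex_measurable_fun f ->
  measurable_fun [set: T] (fun x => cmod (f x) ^+ 2).
Proof.
move=> [f1 f2]; under eq_fun do rewrite cmod_sqr.
by apply: measurable_funD; exact: measurable_funX.
Qed.

Lemma L2normE f : L2norm m f = ((\int[m]_x (cmod (f x) ^+ 2)%:E) `^ (2^-1))%E.
Proof.
rewrite /L2norm unlock; congr poweR; apply: eq_integral => x _.
by rewrite /= ger0_norm ?cmod_ge0// powR_mulrn// cmod_ge0.
Qed.

Lemma in_L2_integrable f : in_L2 m f ->
  m.-integrable [set: T] (EFin \o (fun x => cmod (f x) ^+ 2)).
Proof.
move=> [mf fL2]; apply/integrableP; split.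
  by apply/measurable_EFinP; exact: complex_measurable_cmod_sqr.
rewrite (@eq_integral _ _ _ m setT (fun x => (cmod (f x) ^+ 2)%:E)); last first.
  by move=> x _; rewrite /= ger0_norm// sqr_ge0.
move: fL2; rewrite L2normE; case: (integral _ _ _) => //= [r _|].
  exact: ltry.
by rewrite invr_eq0 pnatr_eq0.
Qed.

Lemma L2norm_le1 f : in_L2 m f -> (L2norm m f <= 1)%E ->
  \int[m]_x (cmod (f x) ^+ 2) <= 1.
Proof.
move=> /in_L2_integrable/(integrable_fin_num measurableT) fin.
rewrite L2normE /Rintegral.
have : (0 <= \int[m]_x ((cmod (f x) ^+ 2)%:E))%E.
  by apply: integral_ge0 => x _; rewrite lee_fin sqr_ge0.
move: fin => /=; case: (integral _ _ _) => //= r _; rewrite !lee_fin => r0.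
rewrite powR12_sqrt// -[X in _ <= X -> _]sqrtr1 => r1.
by rewrite -(ler_sqrt _ ler01).
Qed.

Lemma cintegrable_L2M f g M : in_L2 m f -> complex_measurable_fun g ->
  (forall x, cmod (g x) <= M) -> cintegrable (fun x => f x * g x).
Proof.
move=> fL2 mg gM; have [mf _] := fL2.
apply: (@cintegrable_dominated _ (fun x => M * (1 + cmod (f x) ^+ 2))).
- exact: complex_measurableM.
- apply: RintegrableZ.
  exact: (integrableD measurableT (integrable_cst 1) (in_L2_integrable fL2)).
- move=> x; rewrite cmodM mulrC; apply: ler_pM; rewrite ?cmod_ge0//.
  by have := sqr_ge0 (cmod (f x) - 1); have := cmod_ge0 (f x); nra.
Qed.

Lemma cintegrable_L2_sqr f : in_L2 m f -> cintegrable (fun x => f x * (f x)^*).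
Proof.
move=> fL2; have [mf _] := fL2.
apply: cintegrable_dominated (in_L2_integrable fL2) _.
  by apply: complex_measurableM => //; exact: complex_measurableC.
by move=> x; rewrite cmodM cmodC expr2.
Qed.

(** Bessel's inequality for an orthogonal system, [w i] being the inverse of the
    squared norm of [e i]: expand the nonnegative integral of [|f - g|^2], where
    [g] is the orthogonal projection of [f]. Boundedness of the [e i] makes every
    product that occurs integrable. *)
Lemma bessel (I : finType) (e : I -> T -> R[i]) (w : I -> R) M f :
  in_L2 m f -> (forall i, complex_measurable_fun (e i)) ->
  (forall i x, cmod (e i x) <= M) -> (forall i, w i != 0) ->
  (forall i j, complex_integral m (fun x => e i x * (e j x)^*) =
    (if i == j then ((w i)^-1)%:C%C else 0)) ->
  \sum_i w i * cmod (complex_integral m (fun x => f x * (e i x)^*)) ^+ 2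
    <= \int[m]_x (cmod (f x) ^+ 2).
Proof.
move=> fL2 me eM w0 orth.
pose c i := complex_integral m (fun x => f x * (e i x)^*).
pose W i : R[i] := (w i)%:C%C.
pose g x := \sum_i W i * c i * e i x.
pose S := \sum_i w i * cmod (c i) ^+ 2.
have ife i : cintegrable (fun x => f x * (e i x)^*).
  apply: (cintegrable_L2M fL2 (complex_measurableC (me i))) => x.
  by rewrite cmodC; exact: eM.
have iee i j : cintegrable (fun x => e i x * (e j x)^*).
  apply: (@cintegrable_bounded _ (M * M)).
    by apply: complex_measurableM => //; exact: complex_measurableC.
  by move=> x; rewrite cmodM cmodC ler_pM ?cmod_ge0.
have expand x : (f x - g x) * (f x - g x)^* = f x * (f x)^* +
    ((-1) * (\sum_i (W i * (c i)^*) * (f x * (e i x)^*)) +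
     ((-1) * (\sum_i (W i * c i) * (f x * (e i x)^*)^*) +
     \sum_i \sum_j (W i * c i * (W j * (c j)^*)) * (e i x * (e j x)^*))).
  have gC : (g x)^* = \sum_i W i * (c i)^* * (e i x)^*.
    rewrite /g rmorph_sum; apply: eq_bigr => i _ /=.
    by rewrite !rmorphM /=; congr (_ * _ * _); exact: conjC_realR.
  have -> : \sum_i (W i * (c i)^*) * (f x * (e i x)^*) = f x * (g x)^*.
    by rewrite gC mulr_sumr; apply: eq_bigr => i _; ring.
  have -> : \sum_i (W i * c i) * (f x * (e i x)^*)^* = (f x)^* * g x.
    rewrite mulr_sumr; apply: eq_bigr => i _.
    by rewrite rmorphM /= conjCK; ring.
  have -> : \sum_i \sum_j (W i * c i * (W j * (c j)^*)) * (e i x * (e j x)^*) =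
      g x * (g x)^*.
    rewrite gC mulr_suml; apply: eq_bigr => i _; rewrite mulr_sumr.
    by apply: eq_bigr => j _; ring.
  by rewrite rmorphB /=; ring.
have i1 : cintegrable (fun x => \sum_i (W i * (c i)^*) * (f x * (e i x)^*)).
  by apply: cintegrable_sum => i _; apply: cintegrableZ.
have i2 : cintegrable (fun x => \sum_i (W i * c i) * (f x * (e i x)^*)^*).
  by apply: cintegrable_sum => i _; apply: cintegrableZ; exact: cintegrableC.
have i3 : cintegrable (fun x => \sum_i \sum_j
    (W i * c i * (W j * (c j)^*)) * (e i x * (e j x)^*)).
  by apply: cintegrable_sum => i _; apply: cintegrable_sum => j _; apply: cintegrableZ.
have i0 := cintegrable_L2_sqr fL2.
have SE : S%:C%C = \sum_i W i * (c i * (c i)^*).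
  by rewrite rmorph_sum; apply: eq_bigr => i _; rewrite rmorphM /= cmodK.
have : complex_integral m (fun x => (f x - g x) * (f x - g x)^*) =
    ((\int[m]_x (cmod (f x) ^+ 2)) - S)%:C%C.
  rewrite (funext expand) complex_integralD//; last first.
    apply: cintegrableD; first exact: cintegrableZ.
    by apply: cintegrableD => //; exact: cintegrableZ.
  rewrite complex_integralD//; first last.
  - by apply: cintegrableD => //; exact: cintegrableZ.
  - exact: cintegrableZ.
  rewrite complex_integralD//; [|exact: cintegrableZ].
  rewrite !complex_integralZ// !complex_integral_sum//; last first.
  - by move=> i _; exact: cintegrableZ.
  - by move=> i _; apply: cintegrableZ; exact: cintegrableC.
  - by move=> i _; apply: cintegrable_sum => j _; exact: cintegrableZ.
  rewrite complex_integral_cmod_sqr rmorphB; congr (_ + _) => /=.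
  rewrite [X in -1 * X + _](_ : _ = S%:C%C); last first.
    rewrite SE; apply: eq_bigr => i _; rewrite complex_integralZ// -/(c i); ring.
  rewrite [X in _ + (-1 * X + _)](_ : _ = S%:C%C); last first.
    rewrite SE; apply: eq_bigr => i _.
    rewrite complex_integralZ; last exact: cintegrableC.
    by rewrite complex_integralC// -/(c i); ring.
  rewrite [X in _ + (_ + X)](_ : _ = S%:C%C); first by ring.
  rewrite SE; apply: eq_bigr => i _; rewrite complex_integral_sum; last first.
    by move=> j _; exact: cintegrableZ.
  rewrite (bigD1 i)//= [X in _ + X]big1 ?addr0; last first.
    by move=> j ji; rewrite complex_integralZ// orth eq_sym (negbTE ji) mulr0.
  rewrite complex_integralZ// orth eqxx.
  have -> : W i * c i * (W i * (c i)^*) * ((w i)^-1)%:C%C =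
     W i * (c i * (c i)^*) * (W i * ((w i)^-1)%:C%C) by ring.
  by rewrite -rmorphM /= mulfV// mulr1.
rewrite complex_integral_cmod_sqr => /complexI fg.
rewrite -subr_ge0 -fg; apply: Rintegral_ge0 => x _; exact: sqr_ge0.
Qed.

End ComplexIntegral.

(** * Translation invariance and matrix coefficients *)

Section HaarInvariance.
Variables (R : realType) (G : topGroupType).

Lemma continuous_mulgl (y : G) : continuous (fun x : G => (y * x)%g).
Proof.
move=> x.
apply: (@continuous_comp _ _ _ (fun x : G => (y, x)) (fun xy : G * G => (xy.1 * xy.2)%g)).
  by apply: cvg_pair => /=; [exact: cvg_cst|exact: cvg_id].
exact: mulg_continuous.
Qed.

Lemma continuous_borel_measurable (h : G -> R) : continuous h ->
  measurable_fun [set: borel G] (h : borel G -> R).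
Proof.
move=> /continuousP ch; apply: (measurability _ (RGenOpens.measurableE R)) => //.
move=> _ [_ [a [b ->]] <-]; rewrite setTI; apply: sub_sigma_algebra.
by apply: ch; exact: interval_open.
Qed.

Lemma mulg_measurable (y : G) :
  measurable_fun [set: borel G] (fun x : borel G => (y * x)%g : borel G).
Proof.
apply: (@measurability _ _ (borel G) (borel G) setT _ (@open G)) => // _ [U oU <-].
rewrite setTI; apply: sub_sigma_algebra.
by have /continuousP := @continuous_mulgl y; exact.
Qed.

Lemma continuous_cmod_le (h : R[i] -> R) :
  (forall z w, `|h z - h w| <= cmod (z - w)) -> continuous (h : R[i]^o -> R).
Proof.
move=> h_lip z A /nbhs_ballP[e /= e0 eA].
apply/(@nbhs_ballP _ R[i]^o); exists e%:C%C => /=; first by rewrite ltcR.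
move=> w zw; apply: eA; apply: le_lt_trans (h_lip z w) _.
by move: zw; rewrite -ball_normE /= (cmodE (z - w)) ltcR.
Qed.

Lemma continuous_Re : continuous (@complex.Re R : R[i]^o -> R).
Proof.
apply: continuous_cmod_le => z w; apply: le_trans (norm_Re_le _).
by rewrite ReB.
Qed.

Lemma continuous_Im : continuous (@complex.Im R : R[i]^o -> R).
Proof.
apply: continuous_cmod_le => z w; apply: le_trans (norm_Im_le _).
by rewrite ImB.
Qed.

Variable m : probability (borel G) R.
Hypothesis m_inv : bi_invariant m.

Lemma haar_mulgl (y : G) (A : set (borel G)) : measurable A ->
  m ((fun x : borel G => (y * x)%g : borel G) @^-1` A) = m A.
Proof.
move=> mA; have [<- _] := m_inv (y^-1)%g mA; congr (m _).
apply/seteqP; split => [x Ax|_ [x Ax <-]] /=; last by rewrite mulKVg.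
by exists (y * x)%g => //; rewrite mulKg.
Qed.

(** Change of variables: the measure is its own image under translation. *)
Lemma Rintegral_haar_mulgl (y : G) (h : borel G -> R) M :
  measurable_fun [set: borel G] h -> (forall x, `|h x| <= M) ->
  \int[m]_x h (y * x)%g = \int[m]_x h x.
Proof.
move=> mh hM; congr fine.
pose phi := (fun x : borel G => (y * x)%g : borel G).
have mphi : measurable_fun [set: borel G] phi := mulg_measurable y.
rewrite -[LHS]/(\int[m]_(x in phi @^-1` setT) ((EFin \o h) \o phi) x)%E.
rewrite -integral_pushforward//.
- by apply: eq_measure_integral => A mA _; exact: haar_mulgl.
- exact/measurable_EFinP.
- apply: (@le_integrable _ _ _ m _ _ _ (EFin \o (fun=> M))) => //.
  + exact: measurableT.
  + apply/measurable_EFinP; exact: (measurableT_comp mh mphi).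
  + by move=> x _; rewrite lee_fin (le_trans (hM _))// ler_norm.
  + exact: integrable_cst.
Qed.

Lemma complex_integral_haar_mulgl (y : G) (h : borel G -> R[i]) M :
  complex_measurable_fun h -> (forall x, cmod (h x) <= M) ->
  complex_integral m (fun x : borel G => h (y * x)%g) = complex_integral m h.
Proof.
move=> [h1 h2] hM; congr Complex.
  apply: (@Rintegral_haar_mulgl y (fun x => complex.Re (h x)) M) => // x.
  exact: le_trans (norm_Re_le _) (hM _).
apply: (@Rintegral_haar_mulgl y (fun x => complex.Im (h x)) M) => // x.
exact: le_trans (norm_Im_le _) (hM _).
Qed.

Lemma rep_measurable (p : mxrep R G) i j : unitary_rep p ->
  complex_measurable_fun (fun x : borel G => p x i j).
Proof.
case=> _ _ _ cp.
have c : continuous (fun x : G => p x i j : R[i]^o).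
  have -> : (fun x : G => p x i j : R[i]^o) =
      (fun M : 'cV[R[i]^o]_(deg p) => M i 0) \o (fun x : G => p x *m delta_mx j 0).
    by apply/funext => x /=; rewrite -colE mxE.
  move=> x; apply: continuous_comp; first exact: cp.
  exact: coord_continuous.
split; apply: continuous_borel_measurable => x.
  apply: (@continuous_comp _ _ _ (fun x : G => p x i j : R[i]^o) (@complex.Re R)).
    exact: c.
  exact: continuous_Re.
apply: (@continuous_comp _ _ _ (fun x : G => p x i j : R[i]^o) (@complex.Im R)).
  exact: c.
exact: continuous_Im.
Qed.

End HaarInvariance.

(** * Schur orthogonality *)

Section Schur.
Variables (R : realType) (G : topGroupType).
Implicit Types p q : mxrep R G.

Lemma rep_adjoint p x : unitary_rep p -> (p x)^t* = p (x^-1)%g.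
Proof.
move=> [p1 pM pU _].
have inv : p x *m p (x^-1)%g = 1%:M by rewrite -pM mulgV p1.
have uinv := mulmx1C (unitarymxP (pU x)).
by rewrite -[RHS]mul1mx -uinv -mulmxA inv mulmx1.
Qed.

(** The columns killed by [W - c], for an eigenvalue [c] of [W], form a nonzero
    invariant subspace, hence the whole space. *)
Lemma schur_scalar p (W : 'M[R[i]]_(deg p)) : irreducible_rep p ->
  (forall x, W *m p x = p x *m W) -> exists c, W = c%:M.
Proof.
move=> [p0 irr] Wp.
have [c /eigenvalueP[v vW v0]] := eigenvalue_closed W^T p0.
have Wv : W *m v^T = c *: v^T by rewrite -[W]trmxK -trmx_mul vW linearZ.
exists c; pose K := lker (linfun (mulmx (W - c%:M) : 'cV[R[i]]_(deg p) -> _)).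
have memK u : (u \in K) = ((W - c%:M) *m u == 0) by rewrite memv_ker lfunE.
case: (irr K) => [x u|K0|Kfull].
- rewrite !memK => /eqP Wu; apply/eqP.
  rewrite mulmxA mulmxBl Wp mul_scalar_mx -mul_mx_scalar -mulmxBr -mulmxA Wu.
  by rewrite mulmx0.
- have : v^T \in K by rewrite memK mulmxBl Wv mul_scalar_mx subrr.
  by rewrite K0 memv0 => /eqP vT0; case/eqP: v0; rewrite -[v]trmxK vT0 trmx0.
- apply/eqP; rewrite -subr_eq0; apply/eqP/matrixP => i j.
  have : delta_mx j 0 \in K by rewrite Kfull memvf.
  by rewrite memK => /eqP/matrixP/(_ i 0); rewrite -colE !mxE.
Qed.

(** [W^t* *m W] and [W *m W^t*] commute with the representations, hence are
    scalar, with the same scalar if [W] is nonzero; then a multiple of [W] is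
    unitary and intertwines [p] and [q]. *)
Lemma schur_intertwiner p q (W : 'M[R[i]]_(deg q, deg p)) :
  unitary_rep p -> irreducible_rep p -> unitary_rep q -> irreducible_rep q ->
  (forall x, W *m p x = q x *m W) -> ~ unitarily_equivalent p q -> W = 0.
Proof.
move=> up ip uq iq Wpq neq; apply: contrapT => W0; apply: neq.
have hs_gt0 : 0 < hs W.
  rewrite lt_neqAle hs_ge0 andbT eq_sym; apply/eqP => hsW; apply: W0.
  by case: (@hs_norm R (deg q) (deg p)) => _ /(_ _ hsW).
have Wpq' x : p x *m W^t* = W^t* *m q x.
  have := congr1 (fun A : 'M[R[i]]_(deg q, deg p) => A^t*) (Wpq (x^-1)%g).
  by rewrite /= !trmx_mul !map_mxM /= !rep_adjoint// invgK.
have [x|c Wc] := @schur_scalar p (W^t* *m W) ip.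
  by rewrite -mulmxA Wpq mulmxA -Wpq' mulmxA.
have [x|c' Wc'] := @schur_scalar q (W *m W^t*) iq.
  by rewrite -mulmxA -Wpq' mulmxA Wpq mulmxA.
have cc' : c' = c.
  have : c *: W = c' *: W.
    by rewrite -mul_mx_scalar -Wc mulmxA Wc' mul_scalar_mx.
  move/eqP; rewrite -subr_eq0 -scalerBl scaler_eq0 subr_eq0 => /orP[/eqP->//|/eqP//].
have d0 : 0 < (deg q)%:R :> R by case: iq => d0 _; rewrite ltr0n.
have cE : c = (hs W ^+ 2 / (deg q)%:R)%:C%C.
  apply: (@mulIf _ (deg q)%:R); first by rewrite pnatr_eq0 -(pnatr_eq0 R) lt0r_neq0.
  rewrite -[X in _ = _ * X](rmorph_nat (real_complex R)) -rmorphM /= divfK ?lt0r_neq0//.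
  by rewrite hs_trace Wc' cc' mxtrace_scalar mulr_natr.
(* [r] normalizes [W], because [c = hs W ^+ 2 / deg q] by taking traces. *)
pose r : R := Num.sqrt (deg q)%:R / hs W.
have rr : r%:C%C * (r%:C%C)^* * c = 1.
  rewrite conjC_realR cE -!rmorphM /= -expr2 expr_div_n sqr_sqrtr ?ler0n//.
  by rewrite mulrA divfK ?expf_neq0 ?lt0r_neq0// divff// lt0r_neq0.
have adjZ m n (A : 'M[R[i]]_(m, n)) : (r%:C%C *: A)^t* = (r%:C%C)^* *: A^t*.
  by apply/matrixP => i j; rewrite !mxE rmorphM.
exists (r%:C%C *: W); split.
- apply/unitarymxP; rewrite adjZ -scalemxAl -scalemxAr scalerA Wc' cc'.
  by rewrite scale_scalar_mx rr.
- apply/unitarymxP; rewrite trmxCK adjZ -scalemxAl -scalemxAr scalerA Wc.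
  by rewrite scale_scalar_mx [X in X * c]mulrC rr.
- by move=> x; rewrite -scalemxAl Wpq scalemxAr.
Qed.

Variable m : probability (borel G) R.
Hypothesis m_inv : bi_invariant m.

Lemma rep_coef_integrable p q i j a b : unitary_rep p -> unitary_rep q ->
  cintegrable m (fun x : borel G => p x i j * (q x a b)^*).
Proof.
move=> up uq; apply: (@cintegrable_bounded _ _ _ _ _ 1).
  apply: complex_measurableM; first exact: rep_measurable.
  by apply: complex_measurableC; exact: rep_measurable.
move=> x; rewrite cmodM cmodC -[1]mulr1.
case: up => _ _ pU _; case: uq => _ _ qU _.
by apply: ler_pM; rewrite ?cmod_ge0 ?unitarymx_entry_le1.
Qed.

(** The integral of [p x *m delta_mx j b *m (q x)^t*], the mean over the group
    of a matrix unit. *)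
Definition coef_mx p q (j : 'I_(deg p)) (b : 'I_(deg q)) : 'M[R[i]]_(deg p, deg q) :=
  \matrix_(i, a) complex_integral m (fun x : borel G => p x i j * (q x a b)^*).

(** Means over the group are invariant under translation by [y]. *)
Lemma coef_mx_intertwines p q j b y : unitary_rep p -> unitary_rep q ->
  @coef_mx p q j b *m q y = p y *m coef_mx j b.
Proof.
move=> up uq; have [_ pM _ _] := up; have [_ qM qU _] := uq.
suff E : p y *m coef_mx j b *m (q y)^t* = coef_mx j b.
  by rewrite -{1}E -mulmxA (mulmx1C (unitarymxP (qU y))) mulmx1.
apply/matrixP => i a; rewrite [RHS]mxE.
rewrite -(@complex_integral_haar_mulgl _ _ m m_inv y
  (fun x : borel G => p x i j * (q x a b)^*) 1); first last.
- move=> x; rewrite cmodM cmodC -[1]mulr1; case: up => _ _ pU _.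
  by apply: ler_pM; rewrite ?cmod_ge0 ?unitarymx_entry_le1.
- apply: complex_measurableM; first exact: rep_measurable.
  by apply: complex_measurableC; exact: rep_measurable.
have -> : (fun x : borel G => p (y * x)%g i j * (q (y * x)%g a b)^*) =
    (fun x : borel G => \sum_a' \sum_i' (p y i i' * (q y a a')^*) *
       (p x i' j * (q x a' b)^*)).
  apply/funext => x; rewrite pM qM !mxE rmorph_sum mulr_sumr.
  apply: eq_bigr => a' _; rewrite mulr_suml; apply: eq_bigr => i' _.
  rewrite rmorphM /=; ring.
have ip i' a' : cintegrable m (fun x : borel G => (p y i i' * (q y a a')^*) *
       (p x i' j * (q x a' b)^*)).
  by apply: cintegrableZ; exact: rep_coef_integrable.
rewrite complex_integral_sum; last by move=> a' _; apply: cintegrable_sum.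
rewrite mxE; apply: eq_bigr => a' _.
rewrite complex_integral_sum// !mxE mulr_suml; apply: eq_bigr => i' _.
rewrite complex_integralZ; last exact: rep_coef_integrable.
rewrite !mxE; ring.
Qed.

Lemma schur_orthogonality_neq p q i j a b :
  unitary_rep p -> irreducible_rep p -> unitary_rep q -> irreducible_rep q ->
  ~ unitarily_equivalent p q ->
  complex_integral m (fun x : borel G => q x i j * (p x a b)^*) = 0.
Proof.
move=> up ip uq iq neq.
have /matrixP/(_ i a) : coef_mx j b = 0.
  apply: (schur_intertwiner up ip uq iq) => // x; exact: coef_mx_intertwines.
by rewrite !mxE.
Qed.

(** The scalar by which [coef_mx j b] acts is found from its trace, since the
    columns of [p x] are orthonormal. *)
Lemma schur_orthogonality p i j a b : unitary_rep p -> irreducible_rep p ->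
  complex_integral m (fun x : borel G => p x i j * (p x a b)^*) =
  if (i == a) && (j == b) then ((deg p)%:R^-1)%:C%C else 0.
Proof.
move=> up ip; have [p0 _] := ip; have [_ _ pU _] := up.
have [x|c Wc] := @schur_scalar p (coef_mx j b) ip.
  exact: coef_mx_intertwines.
have d0 : (deg p)%:R != 0 :> R[i] by rewrite pnatr_eq0 -lt0n.
have trW : \tr (coef_mx j b) = (j == b)%:R.
  transitivity (complex_integral m (fun x : borel G => \sum_i p x i j * (p x i b)^*)).
    rewrite complex_integral_sum; last by move=> k _; exact: rep_coef_integrable.
    by apply: eq_bigr => k _; rewrite mxE.
  rewrite (_ : (fun x : borel G => _) = fun=> (j == b)%:R) ?complex_integral_cst//.
  apply/funext => x.
  have /matrixP/(_ b j) := mulmx1C (unitarymxP (pU x)).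
  rewrite !mxE eq_sym => <-; apply: eq_bigr => k _.
  by rewrite !mxE mulrC.
have -> : complex_integral m (fun x : borel G => p x i j * (p x a b)^*) =
    c *+ (i == a).
  by have /matrixP/(_ i a) := Wc; rewrite !mxE.
have cE : c = (j == b)%:R / (deg p)%:R.
  by rewrite -trW Wc mxtrace_scalar -(mulr_natr c) mulfK.
rewrite cE; case: (i == a) => //=; rewrite mulr1n; case: (j == b); rewrite /= ?mul0r//.
by rewrite mul1r fmorphV rmorph_nat.
Qed.

Variables (L : set nat) (pi_ : nat -> mxrep R G).
Hypothesis pi_dual : enumerates_dual L pi_.

(** The matrix coefficients of the representations listed in [s] form an
    orthogonal system, with squared norms [(deg p)^-1]. Positions in [s] rather
    than its elements index it, to have a finite type. *)
Lemma fourier_bessel f (s : seq nat) : in_L2 m (f : borel G -> R[i]) ->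
  uniq s -> (forall n, n \in s -> (0%N |` L) n) ->
  \sum_(n <- s) (deg (pi_ n))%:R * hs (fourier m f (pi_ n)) ^+ 2
    <= \int[m]_x (cmod (f x) ^+ 2).
Proof.
move=> fL2 us sL; case: pi_dual => _ _ irr inj _.
pose k (i : 'I_(size s)) := nth 0%N s i.
have kL i : (0%N |` L) (k i) by apply: sL; exact: mem_nth.
pose I := {i : 'I_(size s) & ('I_(deg (pi_ (k i))) * 'I_(deg (pi_ (k i))))%type}.
pose e (u : I) (x : borel G) := pi_ (k (tag u)) x (tagged u).1 (tagged u).2.
pose w (u : I) : R := (deg (pi_ (k (tag u))))%:R.
have := @bessel _ _ _ m _ e w 1 f fL2.
rewrite (_ : \sum_u _ = \sum_(n <- s) (deg (pi_ n))%:R * hs (fourier m f (pi_ n)) ^+ 2).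
  apply.
  - by move=> u; apply: rep_measurable; case: (irr _ (kL (tag u))).
  - move=> u x; apply: unitarymx_entry_le1.
    by case: (irr _ (kL (tag u))) => -[].
  - move=> u; rewrite pnatr_eq0 -lt0n.
    by case: (irr _ (kL (tag u))) => _ [].
  - move=> [i1 [a1 b1]] [i2 [a2 b2]]; have [i12|i12] := eqVneq i1 i2.
      subst i2; rewrite eq_Tagged /= xpair_eqE.
      by apply: schur_orthogonality; case: (irr _ (kL i1)).
    have -> : (Tagged (fun i => ('I_(deg (pi_ (k i))) * 'I_(deg (pi_ (k i))))%type) (a1, b1)
       == Tagged _ (a2, b2) :> I) = false.
      by apply/eqP => /(congr1 (@tag _ _)) /= /eqP; rewrite (negbTE i12).
    have [u1 r1] := irr _ (kL i1); have [u2 r2] := irr _ (kL i2).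
    apply: schur_orthogonality_neq => //= eq12.
    have /eqP := inj _ _ (kL i2) (kL i1) eq12.
    by rewrite nth_uniq// => /eqP/val_inj/esym/eqP; rewrite (negbTE i12).
rewrite (big_nth 0%N) big_mkord.
transitivity (\sum_(i < size s) \sum_(ab : 'I_(deg (pi_ (k i))) * 'I_(deg (pi_ (k i))))
   (deg (pi_ (k i)))%:R * cmod (fourier m f (pi_ (k i)) ab.2 ab.1) ^+ 2).
  rewrite sig_big_dep /=; apply: eq_bigr => -[i [a b]] _.
  by rewrite /w /e /= mxE.
apply: eq_bigr => i _; rewrite -mulr_sumr; congr (_ * _).
rewrite hs_sqr exchange_big pair_bigA /=; exact: eq_bigr.
Qed.

End Schur.

(** * The weighted estimate and the conclusion *)

(** Since [2 * h * nu <= (1 + a)^-1 * h ^+ 2 + (1 + a) * nu ^+ 2], twice a finite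
    sum of the [d n * y n] is at most
    [(1 - a ^+ 2) / (1 + a) + (2 - (1 + a)) = 2 * (1 - a)]. *)
Lemma esum_le_amgm (R : realType) (L : set nat) (a : R) (d h nu c y : nat -> R) :
  0 <= a -> (forall n, L n -> 0 <= d n) ->
  (forall n, L n -> d n * nu n ^+ 2 <= c n) ->
  (forall n, L n -> y n <= h n * nu n) ->
  (forall s, uniq s -> (forall n, n \in s -> L n) ->
     \sum_(n <- s) d n * h n ^+ 2 <= 1 - a ^+ 2) ->
  ((1 + a)%:E * (1 + \esum_(n in L) (c n)%:E) <= 2%:E)%E ->
  (a%:E + \esum_(n in L) (d n * y n)%:E <= 1)%E.
Proof.
move=> a0 d0 dnu yh bessel c2.
have a1 : 0 < 1 + a by rewrite ltr_pwDl.
rewrite -leeBrDl// -EFinB; apply: ge_ereal_sup => _ [X [finX XL] <-].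
rewrite fsbig_finite//= sumEFin lee_fin.
set s : seq nat := finmap.enum_fset (fset_set X).
have sL n : n \in s -> L n.
  by move=> ns; apply: XL; apply/set_mem; rewrite -(in_fset_set finX).
have c_le : (1 + a) * (1 + \sum_(n <- s) c n) <= 2.
  rewrite -lee_fin; apply: le_trans c2; rewrite EFinM lee_pmul2l ?lte_fin//.
  rewrite EFinD leeD2l//; apply: esum_ge; exists X; first by split.
  by rewrite fsbig_finite//= sumEFin.
have h_le := bessel s (finmap.fset_uniq _) sL.
have amgm n : n \in s ->
    d n * y n <= 2^-1 * ((1 + a)^-1 * (d n * h n ^+ 2) + (1 + a) * c n).
  move=> /sL Ln; apply: (le_trans (ler_wpM2l (d0 n Ln) (yh n Ln))).
  apply: (@le_trans _ _ (2^-1 * ((1 + a)^-1 * (d n * h n ^+ 2) +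
     (1 + a) * (d n * nu n ^+ 2)))); last first.
    by rewrite ler_pM2l ?invr_gt0// lerD2l ler_pM2l// dnu.
  rewrite -subr_ge0.
  have -> : 2^-1 * ((1 + a)^-1 * (d n * h n ^+ 2) + (1 + a) * (d n * nu n ^+ 2)) -
     d n * (h n * nu n) = 2^-1 * (1 + a)^-1 * d n * (h n - (1 + a) * nu n) ^+ 2.
    by field; rewrite lt0r_neq0.
  by rewrite mulr_ge0 ?sqr_ge0// mulr_ge0 ?d0// divr_ge0 ?invr_ge0 ?ler0n// ltW.
apply: (@le_trans _ _ (\sum_(n <- s)
    2^-1 * ((1 + a)^-1 * (d n * h n ^+ 2) + (1 + a) * c n))).
  by rewrite big_seq [leRHS]big_seq; apply: ler_sum.
rewrite -mulr_sumr big_split /= -!mulr_sumr.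
have : (1 + a)^-1 * \sum_(i <- s) d i * h i ^+ 2 <= 1 - a.
  rewrite ler_pdivrMl//; apply: le_trans h_le _.
  by rewrite le_eqVlt; apply/orP; left; apply/eqP; ring.
move: c_le; rewrite mulrDr mulr1; lra.
Qed.

Lemma triple_mul0 (R : realType) d t (B C : 'M[R[i]]_d) : triple_mul t 0 B C = 0.
Proof.
have h0 (X : 'M[R[i]]_d) : hadamard 0 X = 0.
  by apply/matrixP => i j; rewrite !mxE mul0r.
by case: t => /=; rewrite ?h0 ?mul0mx ?h0.
Qed.

Lemma gen_matrix_fun0 (R : realType) d (H : {group 'S_d}) (chi : 'S_d -> R[i]) :
  (0 < d)%N -> gen_matrix_fun H chi 0 = 0.
Proof.
move=> d0; apply: big1 => s _; rewrite (bigD1 (Ordinal d0))//=.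
by rewrite mxE mul0r mulr0.
Qed.

Theorem theorem2 (R : realType) (G : topGroupType)
  (G_sc : @second_countable G) (G_compact : compact [set: G])
  (G_T2 : hausdorff_space G)
  (m : probability (borel G) R) (m_inv : bi_invariant m)
  (L : set nat) (pi_ : nat -> mxrep R G) (pi_dual : enumerates_dual L pi_)
  (f : G -> R[i]) (f_L2 : in_L2 m (f : borel G -> R[i]))
  (f_le1 : (L2norm m (f : borel G -> R[i]) <= 1)%E)
  (Rs : forall n, 'M[R[i]]_(deg (pi_ n)))
  (N : forall n, 'M[R[i]]_(deg (pi_ n)) -> R)
  (N_norm : forall n, L n -> unitarily_invariant_norm (N n))
  (phi : forall n, 'rV[R[i]]_(deg (pi_ n) * deg (pi_ n)) -> R)
  (phi_gauge : forall n, L n -> symmetric_gauge (phi n))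
  (H : forall n, {group 'S_(deg (pi_ n))})
  (chi : forall n, 'S_(deg (pi_ n)) -> R[i])
  (chi_char : forall n, L n -> degree1_character (H n) (chi n))
  (t : triple_product) (x : G) :
  let f0 : R[i] := fourier m f (trivial_rep R G) ord0 ord0 in
  let a : R := complex.Re f0 in
  let d n : R := (deg (pi_ n))%:R in
  let T n := triple_mul t (fourier m f (pi_ n)) (pi_ n x) (Rs n) in
  let S1 : \bar R := (a%:E + \esum_(n in L) (d n * N n (T n))%:E)%E in
  let S2 : \bar R := (a%:E + \esum_(n in L) (d n * phi n (mxvec (T n)))%:E)%E in
  let S3 : \bar R := (a%:E + \esum_(n in L)
    (d n * cmod (gen_matrix_fun (H n) (chi n) (T n)) `^ (d n)^-1)%:E)%E in
  (0 <= f0 < 1 ->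
    [/\ ((1 + a)%:E * (1 + \esum_(n in L) (d n * N n (Rs n) ^+ 2)%:E)
           <= 2%:E)%E -> (S1 <= 1)%E,
        ((1 + a)%:E * (1 + \esum_(n in L)
             (d n ^+ 5 * phi n (mxvec (Rs n)) ^+ 2)%:E) <= 2%:E)%E ->
          (S2 <= 1)%E &
        ((1 + a)%:E * (1 + \esum_(n in L)
             (d n * (N n (Rs n) ^+ 2 / N n (E11 R _) ^+ 2))%:E) <= 2%:E)%E ->
          (S3 <= 1)%E]) /\
  (f0 = 1 -> [/\ S1 = 1%E, S2 = 1%E & S3 = 1%E]).
Proof.
move=> f0 a d T S1 S2 S3.
have [Lform pi0 irr _ _] := pi_dual.
have L0 : ~ L 0%N by case: Lform => [->|[n0 ->]].
have uB n : L n -> pi_ n x \is unitarymx.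
  by move=> Ln; have [[]] := irr n (or_intror Ln).
have deg_gt0 n : L n -> (0 < deg (pi_ n))%N.
  by move=> Ln; have [_ []] := irr n (or_intror Ln).
pose h n := hs (fourier m f (pi_ n)).
have d_ge0 n : 0 <= d n by rewrite ler0n.
have d_ge1 n : L n -> 1 <= d n by move=> Ln; rewrite ler1n deg_gt0.
have bessel s : uniq s -> (forall n, n \in s -> L n) ->
    \sum_(n <- s) d n * h n ^+ 2 <= 1 - cmod f0 ^+ 2.
  move=> us sL; have u0s : uniq (0%N :: s).
    by rewrite /= us andbT; apply/negP => /sL.
  have s0L n : n \in 0%N :: s -> (0%N |` L) n.
    by rewrite inE => /orP[/eqP->|/sL]; [left|right].
  have := fourier_bessel m_inv pi_dual f_L2 u0s s0L.
  rewrite big_cons pi0 mul1r hs_sqr !big_ord1 => /le_trans/(_ (L2norm_le1 f_L2 f_le1)).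
  by rewrite -lerBrDl.
split=> [/andP[f0_ge0 f0_lt1]|f01].
- have a_ge0 : 0 <= a by move: f0_ge0; rewrite lecE => /andP[].
  have f0E : cmod f0 ^+ 2 = a ^+ 2.
    rewrite cmod_sqr -/a; move: f0_ge0; rewrite lecE => /andP[/eqP -> _].
    by rewrite /= expr0n addr0.
  have bessel' s : uniq s -> (forall n, n \in s -> L n) ->
      \sum_(n <- s) d n * h n ^+ 2 <= 1 - a ^+ 2 by rewrite -f0E; exact: bessel.
  split.
  + apply: (@esum_le_amgm _ L a d h (fun n => N n (Rs n))) => // n Ln.
    exact: (@uinorm_triple_mul R _ t _ _ (Rs n) (uB n Ln) _ (N_norm n Ln)).
  + apply: (@esum_le_amgm _ L a d h (fun n => d n * phi n (mxvec (Rs n)))) => // n Ln.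
      rewrite exprMn mulrA -exprS ler_wpM2r ?sqr_ge0//.
      by rewrite ler_weXn2l// d_ge1.
    exact: (@gauge_triple_mul R _ t _ _ (Rs n) (uB n Ln) _ (phi_gauge n Ln)).
  + apply: (@esum_le_amgm _ L a d h (fun n => N n (Rs n) / N n (E11 R _))) => // n Ln.
      by rewrite expr_div_n.
    exact: (@gen_matrix_fun_triple_mul R _ t _ _ (Rs n) (uB n Ln) _ _ _
      (deg_gt0 n Ln) (N_norm n Ln) (chi_char n Ln)).
have a1 : a = 1 by rewrite /a f01.
have T0 n : L n -> T n = 0.
  move=> Ln; have hn0 : d n * h n ^+ 2 <= 0.
    have := bessel [:: n] isT; rewrite f01 cmod1 expr1n subrr big_seq1; apply.
    by move=> k; rewrite inE => /eqP->.
  have /eqP : h n ^+ 2 = 0.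
    apply: le_anti; rewrite sqr_ge0 andbT.
    rewrite -(pmulr_rle0 _ (lt_le_trans ltr01 (d_ge1 n Ln))).
    exact: hn0.
  rewrite sqrf_eq0 => /eqP h0.
  have fn0 : fourier m f (pi_ n) = 0.
    by case: (@hs_norm R (deg (pi_ n)) (deg (pi_ n))) => _ /(_ _ h0).
  by rewrite /T fn0 triple_mul0.
split; rewrite /S1 /S2 /S3 a1 esum1 ?adde0// => n Ln; rewrite T0//.
- have [nN _] := N_norm n Ln.
  by rewrite (norm0 nN) mulr0.
- have [nphi _ _] := phi_gauge n Ln.
  by rewrite linear0 (norm0 nphi) mulr0.
- rewrite gen_matrix_fun0 ?deg_gt0// cmod0 powR0 ?mulr0//.
  by rewrite invr_eq0 lt0r_neq0// (lt_le_trans ltr01 (d_ge1 n Ln)).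
Qed.
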